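(* Let $2\le p<\infty$, let $\lambda\in\mathbb{C}$ with $|\lambda|=1$ and let $\varphi\in S(\mathbb{D})$. Suppose that the composition operator $C_\varphi$ is bounded on the Besov space $B_p$. Then the operator $\lambda C_\varphi$ is not hypercyclic on $B_p$.
   Context: $\mathbb{D}=\{z\in\mathbb{C}:|z|<1\}$, $H(\mathbb{D})$ is the space of holomorphic functions on $\mathbb{D}$, $S(\mathbb{D})$ is the set of all holomorphic self-maps of $\mathbb{D}$, and $dA(z)=dx\,dy$ is Lebesgue area measure. For $\varphi\in S(\mathbb{D})$, $C_\varphi f=f\circ\varphi$ for $f\in H(\mathbb{D})$. For $1<p<\infty$, the Besov space is $B_p=\{f\in H(\mathbb{D}):\|f\|_{B_p}^p=\int_{\mathbb{D}}|f'(z)|^p(1-|z|^2)^{p-2}\,dA(z)<\infty\}$, a Banach space under the norm $\|f\|_p$ given by $\|f\|_p^p=|f(0)|^p+\|f\|_{B_p}^p$. ''$C_\varphi$ is bounded on $B_p$'' means that $C_\varphi$ is a bounded linear operator from $B_p$ to $B_p$. A continuous linear operator $T$ on a separable infinite-dimensional Banach space $X$ is hypercyclic if there is $f\in X$ whose orbit $\{T^nf:n=0,1,2,\dots\}$ is dense in $X$. *)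

(* Defs.v *)
From HB Require Import structures.
From mathcomp Require Import all_boot all_order all_algebra.
From mathcomp Require Import complex.
From mathcomp Require Import all_classical all_reals all_analysis.
Set Implicit Arguments.
Unset Strict Implicit.
Unset Printing Implicit Defensive.
Import Order.TTheory GRing.Theory Num.Theory.
Import numFieldNormedType.Exports.
Import ComplexField.Normc.
Local Open Scope classical_set_scope.
Local Open Scope complex_scope.
Local Open Scope ring_scope.

(* A normed space is presented as a subspace X of an ambient vector space V,
   with an extended-real functional N that restricts to the norm on X.  Elements
   f, g of X with N (f - g) = 0 stand for the same vector. *)

Section operators.
Context {K : numFieldType} {V : lmodType K} {R : realType}.
Implicit Types (X : set V) (N : V -> \bar R) (T : V -> V).

Definition bounded_linear_operator X N T : Prop :=
  [/\ linear T,
      forall f, X f -> X (T f) &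
      exists M : R, forall f, X f -> (N (T f) <= M%:E * N f)%E].

Definition orbit T (f : V) : set V := range (fun n : nat => iter n T f).

Definition norm_dense X N (A : set V) : Prop :=
  forall g, X g -> forall e : R, 0 < e ->
    exists2 h, A h & (N (h - g)%R < e%:E)%E.

(* Only meant for T continuous and linear on X, in which case orbits of points
   of X stay in X. *)
Definition hypercyclic X N T : Prop :=
  exists2 f, X f & norm_dense X N (orbit T f).

End operators.

(* A function on the unit disc is represented by a total function on R[i]; only
   its values on the disc matter: they determine [holomorphic_disk],
   [besov_integral] and [besov_norm], the disc being open.
   The codomain R[i]^o is R[i] as a vector space over itself. *)

Section besov.
Context {R : realType}.
Implicit Types (p : R).

Definition disk : set R[i] := [set z | `|z| < 1].

(* Differentiability over the field R[i], i.e. complex differentiability. *)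
Definition holomorphic_disk (f : R[i] -> R[i]^o) : Prop :=
  forall z, disk z -> derivable (f : R[i]^o -> R[i]^o) z 1.

Definition holomorphic_selfmap (phi : R[i] -> R[i]) : Prop :=
  holomorphic_disk phi /\ (forall z, disk z -> disk (phi z)).

Definition area_measure := (@lebesgue_measure R \x @lebesgue_measure R)%E.

Definition disk_xy : set (R * R) := [set w | disk (w.1 +i* w.2)].

(* [normc] is the modulus as an element of R, whereas [`|z|] lives in R[i]. *)
Definition besov_integral p (f : R[i] -> R[i]^o) : \bar R :=
  (\int[area_measure]_(w in disk_xy)
     (normc (derive1 f (w.1 +i* w.2)) `^ p *
      (1 - normc (w.1 +i* w.2) ^+ 2) `^ (p - 2))%R%:E)%E.

Definition besov p : set (R[i] -> R[i]^o) :=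
  [set f | holomorphic_disk f /\ (besov_integral p f < +oo)%E].

Definition besov_norm p (f : R[i] -> R[i]^o) : \bar R :=
  poweR ((normc (f 0%R) `^ p)%R%:E + besov_integral p f)%E p^-1.

Definition comp_op (phi : R[i] -> R[i]) (f : R[i] -> R[i]^o) : R[i] -> R[i]^o :=
  f \o phi.

End besov.

(* Main.v *)
Require Import Defs.
From mathcomp Require Import all_boot all_order all_algebra.
From mathcomp Require Import complex.
From mathcomp Require Import all_classical all_reals all_analysis.
From mathcomp Require Import measurable_realfun.
From mathcomp Require Import ring lra.
Set Implicit Arguments.
Unset Strict Implicit.
Unset Printing Implicit Defensive.
Import Order.TTheory GRing.Theory Num.Theory.
Import numFieldNormedType.Exports.
Import ComplexField.Normc.
Local Open Scope classical_set_scope.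
Local Open Scope complex_scope.
Local Open Scope ring_scope.

(** The derivative at the origin is bounded along every orbit, but not on the
    space; so no orbit is dense.

    Two facts make the derivative bounded along orbits.  First, for p >= 2 a
    function f of the Besov space has finite Bloch seminorm
    sup |f'(z)| (1 - |z|), bounded in terms of its Besov integral
    ([bloch_estimate]).  Second, by the Schwarz-Pick lemma a holomorphic
    self-map psi of the disc satisfies |psi'(0)| <= C (1 - |psi(0)|)
    ([weak_schwarz_pick]).  Applied to the iterates phi_n of phi, which are
    again self-maps, they give, for |lam| = 1,
      |(lam^n f o phi_n)'(0)| = |f'(phi_n(0))| |phi_n'(0)|
                             <= C |f'(phi_n(0))| (1 - |phi_n(0)|),
    which is bounded in n ([orbit_derivative_bounded]).  On the other hand the
    functions z |-> c z belong to the space, and functions of norm less than 1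
    have a derivative at 0 bounded by a universal constant
    ([besov_unit_ball_derivative], again by the Bloch estimate).  Hence for c
    large no point of the orbit is within distance 1 of z |-> c z.

    It is never important to have the best constant C.  This freedom shapes the
    complex analysis below: contours are rectangles with sides parallel to the
    axes, so that only integrals over real segments occur, and only the
    imaginary part of a contour integral is ever needed.  Goursat's theorem is
    proved by bisection ([goursat]).  Integrating G / (G(a) (w - a)) over a
    rectangle and over a small square about a then bounds |G(a)| by a multiple
    of the maximum of |G| on the boundary, even if G is only continuous at a
    ([max_principle_up_to_constant]); the difference quotient of g is such a G,
    whence Cauchy's estimate for g'(a) ([cauchy_estimate]).

    For the Bloch estimate, Fubini's theorem provides a rectangle around z, of
    size comparable to 1 - |z|, along whose sides the Besov integrand has a
    controlled integral.  Integrating g' along the sides bounds the oscillation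
    of g on the boundary, and Cauchy's estimate bounds g'(z). *)

(** * Complex derivatives in terms of real moduli *)

Section complex_derivative.
Context {R : realType}.
Implicit Types (f g : R[i] -> R[i]) (z w a B : R[i]).

Lemma normr_normc z : `|z| = (normc z)%:C. Proof. by []. Qed.

Lemma normc_ge0 z : 0 <= normc z.
Proof. by case: z => x y; exact: sqrtr_ge0. Qed.

Lemma normc_gt0 z : (0 < normc z) = (z != 0).
Proof.
rewrite lt_def normc_ge0 andbT; congr negb.
by apply/eqP/eqP => [/eq0_normc//|->]; exact: normc0.
Qed.

(** Differentiability with error bounds in [R], whereas the norm of [R[i]] takes
    its values in [R[i]] itself. *)
Definition has_cderiv f z B := forall e : R, 0 < e ->
  exists2 d : R, 0 < d & forall w, normc (w - z) < d ->
    normc (f w - f z - B * (w - z)) <= e * normc (w - z).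

(** The bridge to the topological notion: a positive radius of [R[i]] is a real
    number, because comparison with 0 in [R[i]] forces a zero imaginary part. *)
Lemma has_cderivP f z B :
  is_derive (z : R[i]^o) 1 (f : R[i]^o -> R[i]^o) B <-> has_cderiv f z B.
Proof.
have quot (h : R[i]) : h != 0 ->
    normc (B - h^-1 *: (f (h *: (1 : R[i]^o) + z) - f z)) * normc h =
    normc (f (z + h) - f z - B * h).
  move=> h0; rewrite -normcM -[RHS]normcN [_ *: (_ - _)]mulrC [h *: _]mulr1.
  by rewrite mulrBl -mulrA mulVf // mulr1 [h + z]addrC [in RHS]opprB.
split=> [[df dE] e e0|H].
- have {}df : (fun h : R[i]^o => h^-1 *: (f (h *: (1 : R[i]^o) + z) - f z) : R[i]^o)
      @ 0^' --> (B : R[i]^o) by rewrite -dE; exact: df.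
  have e0' : 0 < e%:C by rewrite ltcR.
  have /cvgrPdist_le/(_ _ e0') := df.
  rewrite near_withinE => /nbhs_ballP[d /= d0 Hd].
  have dE' : d = (complex.Re d)%:C.
    by apply/eqP; rewrite eq_complex /= eqxx; move: d0; rewrite ltcE => /andP[].
  have d0' : 0 < complex.Re d by move: d0; rewrite ltcE => /andP[].
  exists (complex.Re d) => // w wd.
  have [->|wz] := eqVneq w z.
    by rewrite !subrr mulr0 subr0 normc0 mulr0.
  have wz0 : w - z != 0 by rewrite subr_eq0.
  have := Hd (w - z); rewrite /ball /= sub0r normrN normr_normc dE' ltcR => /(_ wd wz0).
  rewrite normr_normc lecR => Hle.
  have := quot _ wz0; rewrite [z + _]addrC subrK => <-.
  by rewrite ler_wpM2r// normc_ge0.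
- have cv : (fun h : R[i]^o => h^-1 *: (f (h *: (1 : R[i]^o) + z) - f z) : R[i]^o)
      @ 0^' --> (B : R[i]^o).
    apply/cvgrPdist_le => e e0.
    have eE : e = (complex.Re e)%:C.
      by apply/eqP; rewrite eq_complex /= eqxx; move: e0; rewrite ltcE => /andP[].
    have e0' : 0 < complex.Re e by move: e0; rewrite ltcE => /andP[].
    have [d d0 Hd] := H _ e0'.
    rewrite near_withinE; apply/nbhs_ballP; exists d%:C => /=; first by rewrite ltcR.
    move=> h; rewrite /ball /= sub0r normrN normr_normc ltcR => hd h0.
    rewrite eE normr_normc lecR -(ler_pM2r (_ : 0 < normc h)) ?normc_gt0// quot//.
    by have := Hd (z + h); rewrite [z + h]addrC addrK; apply.
  split; first by apply/cvg_ex; exists B; exact: cv.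
  by apply: cvg_lim => //; exact: cv.
Qed.
End complex_derivative.

(** * Integrals over segments *)

Section segment_integral.
Context {R : realType}.
Notation mu := (@lebesgue_measure R).
Implicit Types (u v F : R -> R) (a b c m : R).

Definition seg_integral u a b : R := \int[mu]_(x in `[a, b]) u x.

Lemma seg_integrable u a b : {in `[a, b], continuous u} ->
  mu.-integrable `[a, b] (EFin \o u).
Proof.
move=> cu; apply: continuous_compact_integrable; first exact: segment_compact.
by apply: continuous_in_subspaceT => x; rewrite inE => /cu.
Qed.

Lemma seg_cst c a b : a <= b -> seg_integral (fun=> c) a b = c * (b - a).
Proof.
move=> ab; rewrite /seg_integral Rintegral_cst//= lebesgue_measure_itv/= lte_fin.
by case: ltP => [_|ba] //=; have -> : a = b by [apply/le_anti/andP]; rewrite subrr.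
Qed.

Lemma segB u v a b : {in `[a, b], continuous u} -> {in `[a, b], continuous v} ->
  seg_integral (fun x => u x - v x) a b = seg_integral u a b - seg_integral v a b.
Proof. by move=> cu cv; apply: RintegralB => //; exact: seg_integrable. Qed.

Lemma le_seg u v a b : {in `[a, b], continuous u} -> {in `[a, b], continuous v} ->
  {in `[a, b], forall x, u x <= v x} -> seg_integral u a b <= seg_integral v a b.
Proof. by move=> cu cv uv; apply: le_Rintegral => //; exact: seg_integrable. Qed.

Lemma seg_split u a m b : a <= m -> m <= b -> {in `[a, b], continuous u} ->
  seg_integral u a b = seg_integral u a m + seg_integral u m b.
Proof.
move=> am mb cu; rewrite /seg_integral -[X in _ + X]Rintegral_itv_obnd_cbnd.
  rewrite -(@Rintegral_itvB _ u (BLeft a) (BRight b) m) ?bnd_simp//.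
    by rewrite addrC subrK.
  exact: seg_integrable.
have := seg_integrable cu; apply: integrableS => //.
by apply: subset_itvr; rewrite bnd_simp.
Qed.

Lemma seg_ftc u F a b : a <= b -> {in `[a, b], continuous u} ->
  {in `[a, b], forall x : R, is_derive x 1 F (u x)} -> seg_integral u a b = F b - F a.
Proof.
rewrite le_eqVlt => /predU1P[->|ab] cu dF.
  by rewrite /seg_integral set_itv1 Rintegral_set1 subrr.
have cF x : x \in `[a, b] -> {for x, continuous F}.
  by move=> /dF [d _]; apply: differentiable_continuous; apply/derivable1_diffP.
rewrite /seg_integral /Rintegral (@continuous_FTC2 _ u F)//.
- by apply: continuous_in_subspaceT => x; rewrite inE => /cu.
- split.
  + by move=> x xab; have /dF[] : x \in `[a, b] by exact: subset_itv_oo_cc.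
  + by apply: cvg_at_right_filter; apply: cF; rewrite in_itv/= lexx ltW.
  + by apply: cvg_at_left_filter; apply: cF; rewrite in_itv/= lexx ltW.
- move=> x xab; have /dF[_ <-] : x \in `[a, b] by exact: subset_itv_oo_cc.
  by rewrite derive1E.
Qed.

End segment_integral.

(** * Additive functions of rectangles *)

Section bisection.
Context {R : realType}.

Lemma exp2_small (S d : R) : 0 < d -> exists n : nat, S / 2 ^+ n < d.
Proof.
move=> d0; exists (Num.truncn (S / d)).+1; set n := (_.+1).
rewrite ltr_pdivrMr ?exprn_gt0// mulrC -ltr_pdivrMr//.
apply: (lt_trans (Num.Theory.truncnS_gt _)).
by rewrite -natrX ltr_nat ltn_expl.
Qed.

(** The bisection argument, free of integrals.  If E does not vanish on a
    rectangle, additivity yields a quarter of it on which |E| is at least a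
    quarter as large; iterating, |E| decreases at most like the area of the
    nested rectangles, against the smallness of E near their common point. *)
Lemma additive_rect_eq0 (E : R -> R -> R -> R -> R) (x0 x1 y0 y1 : R) :
  x0 <= x1 -> y0 <= y1 ->
  (forall a m b c d, x0 <= a -> a <= m -> m <= b -> b <= x1 ->
     y0 <= c -> c <= d -> d <= y1 -> E a b c d = E a m c d + E m b c d) ->
  (forall a b c m d, x0 <= a -> a <= b -> b <= x1 ->
     y0 <= c -> c <= m -> m <= d -> d <= y1 -> E a b c d = E a b c m + E a b m d) ->
  (forall x y, x0 <= x <= x1 -> y0 <= y <= y1 -> forall e, 0 < e ->
     exists2 r, 0 < r & forall a b c d, x0 <= a <= x -> x <= b <= x1 ->
       y0 <= c <= y -> y <= d <= y1 -> b - a < r -> d - c < r ->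
       `|E a b c d| <= e * (b - a + (d - c)) ^+ 2) ->
  E x0 x1 y0 y1 = 0.
Proof.
move=> x01 y01 addx addy loc; apply/eqP/negPn/negP => E0.
pose rect := ((R * R) * (R * R))%type.
pose good (r : rect) := [/\ x0 <= r.1.1, r.1.1 <= r.1.2 & r.1.2 <= x1] /\
  [/\ y0 <= r.2.1, r.2.1 <= r.2.2 & r.2.2 <= y1].
pose ER (r : rect) := `|E r.1.1 r.1.2 r.2.1 r.2.2|.
pose sub (r' r : rect) := [/\ r.1.1 <= r'.1.1, r'.1.2 <= r.1.2,
  r.2.1 <= r'.2.1 & r'.2.2 <= r.2.2].
pose half (r' r : rect) := r'.1.2 - r'.1.1 = (r.1.2 - r.1.1) / 2 /\
  r'.2.2 - r'.2.1 = (r.2.2 - r.2.1) / 2.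
have /choice[s Hs] : forall r : rect, exists r' : rect,
    good r -> [/\ good r', sub r' r, half r' r & ER r <= 4 * ER r'].
  move=> [[a b] [c d]]; rewrite /good /sub /half /ER /=.
  have [[[xa ab bx] [yc cd dy]]|?] := pselect ([/\ x0 <= a, a <= b & b <= x1] /\
    [/\ y0 <= c, c <= d & d <= y1]); last by exists ((a, b), (c, d)).
  pose m := (a + b) / 2; pose n := (c + d) / 2.
  have am : a <= m by rewrite /m; lra.
  have mb : m <= b by rewrite /m; lra.
  have cn : c <= n by rewrite /n; lra.
  have nd : n <= d by rewrite /n; lra.
  have EE : `|E a b c d| <= `|E a m c n| + `|E m b c n| + `|E a m n d| + `|E m b n d|.
    rewrite (addx a m b c d)// (addy a m c n d)//; last lra.
    rewrite (addy m b c n d)//; last lra.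
    by rewrite !ler_norml; have := ler_norm (E a m c n); have := ler_norm (E m b c n);
      have := ler_norm (E a m n d); have := ler_norm (E m b n d);
      have := lerNnormlW (lexx `|E a m c n|); have := lerNnormlW (lexx `|E m b c n|);
      have := lerNnormlW (lexx `|E a m n d|); have := lerNnormlW (lexx `|E m b n d|);
      move=> *; apply/andP; split; lra.
  have [h1|h1] := leP `|E a b c d| (4 * `|E a m c n|).
    by exists ((a, m), (c, n)) => _; clear addx addy loc EE; split=> //;
      repeat split; rewrite /= /m /n; lra.
  have [h2|h2] := leP `|E a b c d| (4 * `|E m b c n|).
    by exists ((m, b), (c, n)) => _; clear addx addy loc EE; split=> //;
      repeat split; rewrite /= /m /n; lra.
  have [h3|h3] := leP `|E a b c d| (4 * `|E a m n d|).
    by exists ((a, m), (n, d)) => _; clear addx addy loc EE; split=> //;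
      repeat split; rewrite /= /m /n; lra.
  have [h4|h4] := leP `|E a b c d| (4 * `|E m b n d|).
    by exists ((m, b), (n, d)) => _; clear addx addy loc EE; split=> //;
      repeat split; rewrite /= /m /n; lra.
  lra.
(* The nested rectangles; after n steps the sides are divided by 2^n, E by at
   most 4^n. *)
pose r0 : rect := ((x0, x1), (y0, y1)).
pose r n := iter n s r0.
have gr n : good (r n).
  by elim: n => [|n IH] /=; [split|case: (Hs _ IH)].
have sr n : sub (r n.+1) (r n) by case: (Hs _ (gr n)).
have sz n : (r n).1.2 - (r n).1.1 = (x1 - x0) / 2 ^+ n /\
            (r n).2.2 - (r n).2.1 = (y1 - y0) / 2 ^+ n.
  elim: n => [|n [IH1 IH2]]; first by rewrite expr0 !divr1.
  have [_ _ [-> ->] _] := Hs _ (gr n).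
  by rewrite -/(r n) IH1 IH2 exprSr !invfM !mulrA.
have Er n : ER r0 <= 4 ^+ n * ER (r n).
  elim: n => [|n IH]; first by rewrite expr0 mul1r.
  apply: (le_trans IH); rewrite exprSr -mulrA ler_wpM2l ?exprn_ge0//.
  by case: (Hs _ (gr n)).
have subn n k : sub (r (n + k)%N) (r n).
  elim: k => [|k [i1 i2 i3 i4]]; first by rewrite addn0; split.
  rewrite addnS; have [j1 j2 j3 j4] := sr (n + k)%N.
  by split; [exact: le_trans j1|exact: le_trans i2|exact: le_trans j3|exact: le_trans i4].
have xle n k : (r n).1.1 <= (r k).1.2.
  have [h1 _ _ _] := subn n k; have [_ h2 _ _] := subn k n.
  by have [[_ h _] _] := gr (n + k)%N; move: h2; rewrite addnC; lra.
have yle n k : (r n).2.1 <= (r k).2.2.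
  have [_ _ h1 _] := subn n k; have [_ _ _ h2] := subn k n.
  by have [_ [_ h _]] := gr (n + k)%N; move: h2; rewrite addnC; lra.
have between (u v : nat -> R) : (forall n k, u n <= v k) ->
    exists x, forall n, u n <= x <= v n.
  move=> uv; exists (sup (range u)) => n; apply/andP; split.
    apply: sup_upper_bound; last by exists n.
    split; first by exists (u 0), 0.
    by exists (v 0) => _ [k _ <-].
  by apply: ge_sup; [exists (u 0), 0|move=> _ [k _ <-]].
have [x xr] := between (fun n => (r n).1.1) (fun n => (r n).1.2) xle.
have [y yr] := between (fun n => (r n).2.1) (fun n => (r n).2.2) yle.
(* With this e, the local bound on a small rectangle of the sequence contradicts
   the lower bound on E. *)
pose S := x1 - x0 + (y1 - y0).
pose e := ER r0 / (2 * (S ^+ 2 + 1)).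
have ER0 : 0 < ER r0 by rewrite normr_gt0.
have S0 : 0 <= S ^+ 2 by rewrite sqr_ge0.
have e0 : 0 < e by rewrite divr_gt0//; lra.
have [d d0 Hd] := loc x y (xr 0%N) (yr 0%N) e e0.
have [n nS] := exp2_small S d0.
have [s1 s2] := sz n.
have [[g1 g2 g3] [g4 g5 g6]] := gr n.
have p0 : 0 < (2 : R) ^+ n by rewrite exprn_gt0.
have sS : (x1 - x0) / 2 ^+ n + (y1 - y0) / 2 ^+ n = S / 2 ^+ n.
  by rewrite -mulrDl.
have q1 : 0 <= (x1 - x0) / 2 ^+ n by rewrite divr_ge0 ?subr_ge0// ltW.
have q2 : 0 <= (y1 - y0) / 2 ^+ n by rewrite divr_ge0 ?subr_ge0// ltW.
have /andP[xr1 xr2] := xr n; have /andP[yr1 yr2] := yr n.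
have := Hd (r n).1.1 (r n).1.2 (r n).2.1 (r n).2.2.
rewrite g1 xr1 xr2 g3 g4 yr1 yr2 g6 s1 s2 sS => /(_ erefl erefl erefl erefl).
move=> /(_ ltac:(lra) ltac:(lra)) H.
have := Er n; rewrite leNgt => /negP; apply.
apply: (@le_lt_trans _ _ (4 ^+ n * (e * (S / 2 ^+ n) ^+ 2))).
  by rewrite ler_wpM2l ?exprn_ge0.
have -> : 4 ^+ n * (e * (S / 2 ^+ n) ^+ 2) = e * S ^+ 2.
  have -> : (4 : R) ^+ n = (2 ^+ n) ^+ 2.
    by rewrite -exprM mulnC exprM; congr (_ ^+ n); ring.
  by field; rewrite gt_eqF.
rewrite /e mulrAC ltr_pdivrMr; last lra.
by rewrite ltr_pM2l//; lra.
Qed.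

End bisection.

(** * Goursat's theorem *)

Section goursat.
Context {R : realType}.
Implicit Types (F G : R[i] -> R[i]) (z w A B : R[i]).

Lemma ler_abs_Re z : `|complex.Re z| <= normc z.
Proof. by have := normc_ge_Re z; rewrite normr_normc lecR. Qed.

Lemma ler_abs_Im z : `|complex.Im z| <= normc z.
Proof.
case: z => x y /=; rewrite -sqrtr_sqr ler_sqrt ?addr_ge0 ?sqr_ge0//.
by rewrite lerDr sqr_ge0.
Qed.

Lemma normc_le_ReIm z : normc z <= `|complex.Re z| + `|complex.Im z|.
Proof.
case: z => x y /=; rewrite -[leRHS]ger0_norm ?addr_ge0// -sqrtr_sqr.
rewrite ler_sqrt ?sqr_ge0// sqrrD !real_normK ?num_real//.
by rewrite lerD2r lerDl mulrn_wge0// mulr_ge0.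
Qed.

Lemma normcB z w : normc (z - w) = normc (w - z).
Proof. by rewrite -normcN opprB. Qed.

Lemma normc_real (x : R) : 0 <= x -> normc x%:C = x.
Proof. by move=> x0; rewrite /= expr0n/= addr0 sqrtr_sqr ger0_norm. Qed.

Definition ccontinuous F z := forall e : R, 0 < e ->
  exists2 d : R, 0 < d & forall w, normc (w - z) < d -> normc (F w - F z) < e.

Lemma has_cderiv_ccontinuous F z B : has_cderiv F z B -> ccontinuous F z.
Proof.
move=> dF e e0; have [d d0 H] := dF 1 ltr01.
pose K := 1 + normc B; have K0 : 0 < K by rewrite ltr_pwDl// normc_ge0.
exists (Num.min d (e / K)); first by rewrite lt_min d0 divr_gt0.
move=> w; rewrite lt_min ltr_pdivlMr// => /andP[wd we].
apply: le_lt_trans we; have := H w wd; rewrite mul1r => {}H.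
have -> : F w - F z = (F w - F z - B * (w - z)) + B * (w - z) by rewrite subrK.
apply: le_trans (le_normcD _ _) _; rewrite normcM.
by rewrite /K [leRHS]mulrDr mulr1 lerD// mulrC.
Qed.

Lemma ccontinuous_horizontal F x y : ccontinuous F (x +i* y) ->
  {for x, continuous (fun t => complex.Re (F (t +i* y)))} /\
  {for x, continuous (fun t => complex.Im (F (t +i* y)))}.
Proof.
move=> cF; split; apply/cvgrPdist_lt => e /cF[d d0 H]; near=> t;
  (have /H FF : normc (t +i* y - (x +i* y)) < d by
    rewrite (le_lt_trans (normc_le_ReIm _))//= subrr normr0 addr0 distrC; near: t;
    exact: cvgr_dist_lt);
  rewrite distrC; apply: le_lt_trans FF; rewrite -raddfB;
  [exact: ler_abs_Re|exact: ler_abs_Im].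
Unshelve. all: by end_near. Qed.

Lemma ccontinuous_vertical F x y : ccontinuous F (x +i* y) ->
  {for y, continuous (fun t => complex.Re (F (x +i* t)))} /\
  {for y, continuous (fun t => complex.Im (F (x +i* t)))}.
Proof.
move=> cF; split; apply/cvgrPdist_lt => e /cF[d d0 H]; near=> t;
  (have /H FF : normc (x +i* t - (x +i* y)) < d by
    rewrite (le_lt_trans (normc_le_ReIm _))//= subrr normr0 add0r distrC; near: t;
    exact: cvgr_dist_lt);
  rewrite distrC; apply: le_lt_trans FF; rewrite -raddfB;
  [exact: ler_abs_Re|exact: ler_abs_Im].
Unshelve. all: by end_near. Qed.

Lemma seg_near (u : R -> R) (k h a b : R) : a <= b ->
  {in `[a, b], continuous u} -> {in `[a, b], forall x, `|u x - k| <= h} ->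
  `|seg_integral u a b - k * (b - a)| <= h * (b - a).
Proof.
move=> ab cu uk.
have cc (c : R) : {in `[a, b], continuous (fun=> c : R)} by move=> x _; exact: cvg_cst.
have H1 : (k - h) * (b - a) <= seg_integral u a b.
  rewrite -(seg_cst (k - h) ab); apply: le_seg => // x /uk.
  by rewrite ler_norml => /andP[]; lra.
have H2 : seg_integral u a b <= (k + h) * (b - a).
  rewrite -(seg_cst (k + h) ab); apply: le_seg => // x /uk.
  by rewrite ler_norml => /andP[]; lra.
by rewrite ler_norml; apply/andP; split; lra.
Qed.

(** The imaginary part of the integral of F(z) dz along the boundary of
    [a, b] x [c, d], counterclockwise: on horizontal sides dz = dx, on vertical
    sides dz = i dy. *)
Definition im_contour F (a b c d : R) : R :=
  seg_integral (fun x => complex.Im (F (x +i* c))) a b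
  + seg_integral (fun y => complex.Re (F (b +i* y))) c d
  - seg_integral (fun x => complex.Im (F (x +i* d))) a b
  - seg_integral (fun y => complex.Re (F (a +i* y))) c d.

Lemma im_contour_splitx F a m b c d : a <= m -> m <= b ->
  {in `[a, b], forall x, ccontinuous F (x +i* c)} ->
  {in `[a, b], forall x, ccontinuous F (x +i* d)} ->
  im_contour F a b c d = im_contour F a m c d + im_contour F m b c d.
Proof.
move=> am mb hc hd; rewrite /im_contour (seg_split am mb); last first.
  by move=> x /hc /ccontinuous_horizontal[].
rewrite [X in _ + _ - X - _](seg_split am mb); last first.
  by move=> x /hd /ccontinuous_horizontal[].
by ring.
Qed.

Lemma im_contour_splity F a b c m d : c <= m -> m <= d ->
  {in `[c, d], forall y, ccontinuous F (a +i* y)} ->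
  {in `[c, d], forall y, ccontinuous F (b +i* y)} ->
  im_contour F a b c d = im_contour F a b c m + im_contour F a b m d.
Proof.
move=> cm md ha hb; rewrite /im_contour.
rewrite [X in _ + X - _ - _](seg_split cm md); last first.
  by move=> y /hb /ccontinuous_vertical[].
rewrite [X in _ + _ - _ - X](seg_split cm md); last first.
  by move=> y /ha /ccontinuous_vertical[].
by ring.
Qed.

(** Near a point F is affine up to o(|w - z|); the contour integral of an affine
    function over a rectangle is 0, and the error contributes o(size^2), so that
    [additive_rect_eq0] applies. *)
Lemma goursat F (x0 x1 y0 y1 : R) : x0 <= x1 -> y0 <= y1 ->
  (forall x y, x0 <= x <= x1 -> y0 <= y <= y1 -> exists B, has_cderiv F (x +i* y) B) ->
  im_contour F x0 x1 y0 y1 = 0.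
Proof.
move=> x01 y01 dF.
have cF x y : x0 <= x <= x1 -> y0 <= y <= y1 -> ccontinuous F (x +i* y).
  by move=> hx hy; have [B] := dF x y hx hy; exact: has_cderiv_ccontinuous.
apply: (additive_rect_eq0 x01 y01).
- move=> a m b c d ? ? ? ? ? ? ?; apply: im_contour_splitx => // x;
    rewrite in_itv/= => /andP[? ?]; apply: cF; lra.
- move=> a b c m d ? ? ? ? ? ? ?; apply: im_contour_splity => // y;
    rewrite in_itv/= => /andP[? ?]; apply: cF; lra.
move=> x y hx hy e e0.
have [B dB] := dF x y hx hy.
have [r r0 Hr] := dB (e / 2) (divr_gt0 e0 (ltr0Sn _ 1)).
exists (r / 2); first by lra.
move=> a b c d /andP[xa ax] /andP[xb bx] /andP[yc cy] /andP[yd dy] bar dcr.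
set L := b - a + (d - c).
pose rem w := F w - F (x +i* y) - B * (w - (x +i* y)).
have Hrem u v : a <= u <= b -> c <= v <= d -> normc (rem (u +i* v)) <= e / 2 * L.
  move=> /andP[au ub] /andP[cv vd].
  have uL : normc ((u +i* v) - (x +i* y)) <= L.
    rewrite (le_trans (normc_le_ReIm _))//=.
    have : `|u - x| <= b - a by rewrite ler_norml; lra.
    have : `|v - y| <= d - c by rewrite ler_norml; lra.
    by rewrite /L; lra.
  rewrite (le_trans (Hr _ _))//; first by apply: le_lt_trans uL _; rewrite /L; lra.
  by rewrite ler_wpM2l//; lra.
have Fdecomp u v : F (u +i* v) = F (x +i* y) + B * ((u - x) +i* (v - y)) + rem (u +i* v).
  have -> : ((u - x) +i* (v - y)) = (u +i* v) - (x +i* y) by [].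
  by rewrite /rem; ring.
(* With B = al + i be, the affine part contributes al (c - d) (b - a) through the
   horizontal sides and the opposite amount through the vertical ones. *)
have [al [be Bab]] : exists al be, B = al +i* be by case: (B) => al be; exists al, be.
have [p [q Fpq]] : exists p q, F (x +i* y) = p +i* q.
  by case: (F _) => p q; exists p, q.
have ReF u v : complex.Re (F (u +i* v)) =
    p + (al * (u - x) - be * (v - y)) + complex.Re (rem (u +i* v)).
  by rewrite Fdecomp Fpq Bab; case: (rem _) => ? ?.
have ImF u v : complex.Im (F (u +i* v)) =
    q + (al * (v - y) + be * (u - x)) + complex.Im (rem (u +i* v)).
  by rewrite Fdecomp Fpq Bab; case: (rem _) => ? ?.
have ab : a <= b by lra.
have cd : c <= d by lra.
have cFh v : c <= v <= d -> {in `[a, b], continuous (fun t => complex.Im (F (t +i* v)))}.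
  move=> hv t; rewrite in_itv/= => ht.
  have [] : _ /\ _ := ccontinuous_horizontal (cF t v ltac:(lra) ltac:(lra)).
  by [].
have cFv u : a <= u <= b -> {in `[c, d], continuous (fun t => complex.Re (F (u +i* t)))}.
  move=> hv t; rewrite in_itv/= => ht.
  have [] : _ /\ _ := ccontinuous_vertical (cF u t ltac:(lra) ltac:(lra)).
  by [].
have Lnn : 0 <= L by rewrite /L; lra.
have H1 : `|seg_integral (fun t => complex.Im (F (t +i* c)) - complex.Im (F (t +i* d))) a b
      - (al * (c - d)) * (b - a)| <= (e * L) * (b - a).
  apply: seg_near => //.
    by move=> t tab; apply: cvgB; apply: cFh => //; lra.
  move=> t; rewrite in_itv/= => tab; rewrite !ImF.
  have h1 := le_trans (ler_abs_Im _) (Hrem t c tab ltac:(lra)).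
  have h2 := le_trans (ler_abs_Im _) (Hrem t d tab ltac:(lra)).
  set s1 := complex.Im _ in h1 *; set s2 := complex.Im _ in h2 *.
  have -> : q + (al * (c - y) + be * (t - x)) + s1 -
    (q + (al * (d - y) + be * (t - x)) + s2) - al * (c - d) = s1 - s2 by ring.
  by rewrite (le_trans (ler_normB _ _))//; lra.
have H2 : `|seg_integral (fun t => complex.Re (F (b +i* t)) - complex.Re (F (a +i* t))) c d
      - (al * (b - a)) * (d - c)| <= (e * L) * (d - c).
  apply: seg_near => //.
    by move=> t tab; apply: cvgB; apply: cFv => //; lra.
  move=> t; rewrite in_itv/= => tab; rewrite !ReF.
  have h1 := le_trans (ler_abs_Re _) (Hrem b t ltac:(lra) tab).
  have h2 := le_trans (ler_abs_Re _) (Hrem a t ltac:(lra) tab).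
  set s1 := complex.Re _ in h1 *; set s2 := complex.Re _ in h2 *.
  have -> : p + (al * (b - x) - be * (t - y)) + s1 -
    (p + (al * (a - x) - be * (t - y)) + s2) - al * (b - a) = s1 - s2 by ring.
  by rewrite (le_trans (ler_normB _ _))//; lra.
rewrite segB in H1; [|by apply: cFh; lra|by apply: cFh; lra].
rewrite segB in H2; [|by apply: cFv; lra|by apply: cFv; lra].
rewrite /im_contour.
have -> : e * L ^+ 2 = e * L * (b - a) + e * L * (d - c) by rewrite /L; ring.
move: H1 H2; rewrite !ler_norml => /andP[? ?] /andP[? ?].
by apply/andP; split; lra.
Qed.

End goursat.

(** * Integrals of the Cauchy kernel *)

Section cauchy.
Context {R : realType}.
Implicit Types (F G g : R[i] -> R[i]) (z w A B : R[i]).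

(** The region between the rectangle and the square is cut into four rectangles,
    to which Goursat's theorem applies: the part below the square, the part
    above it, and the two parts at its sides. *)
Lemma im_contour_annulus F (p q s x0 x1 y0 y1 : R) : 0 < s ->
  x0 <= p - s -> p + s <= x1 -> y0 <= q - s -> q + s <= y1 ->
  (forall x y, x0 <= x <= x1 -> y0 <= y <= y1 -> x <> p \/ y <> q ->
     exists B, has_cderiv F (x +i* y) B) ->
  im_contour F x0 x1 y0 y1 = im_contour F (p - s) (p + s) (q - s) (q + s).
Proof.
move=> s0 xp px yq qy dF.
have cF x y : x0 <= x <= x1 -> y0 <= y <= y1 -> x <> p \/ y <> q ->
    ccontinuous F (x +i* y).
  by move=> hx hy h; have [B] := dF x y hx hy h; exact: has_cderiv_ccontinuous.
rewrite (@im_contour_splity _ F x0 x1 y0 (q - s) y1); [|lra|lra| |]; last 2 first.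
- by move=> y; rewrite in_itv/= => ?; apply: cF; [lra|lra|left=> ?; lra].
- by move=> y; rewrite in_itv/= => ?; apply: cF; [lra|lra|left=> ?; lra].
rewrite (@im_contour_splity _ F x0 x1 (q - s) (q + s) y1); [|lra|lra| |]; last 2 first.
- by move=> y; rewrite in_itv/= => ?; apply: cF; [lra|lra|left=> ?; lra].
- by move=> y; rewrite in_itv/= => ?; apply: cF; [lra|lra|left=> ?; lra].
rewrite (@im_contour_splitx _ F x0 (p - s) x1 (q - s) (q + s));
  [|lra|lra| |]; last 2 first.
- by move=> x; rewrite in_itv/= => ?; apply: cF; [lra|lra|right=> ?; lra].
- by move=> x; rewrite in_itv/= => ?; apply: cF; [lra|lra|right=> ?; lra].
rewrite (@im_contour_splitx _ F (p - s) (p + s) x1 (q - s) (q + s));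
  [|lra|lra| |]; last 2 first.
- by move=> x; rewrite in_itv/= => ?; apply: cF; [lra|lra|right=> ?; lra].
- by move=> x; rewrite in_itv/= => ?; apply: cF; [lra|lra|right=> ?; lra].
rewrite [im_contour F x0 x1 y0 (q - s)]goursat; [|lra|lra|]; last first.
  by move=> x y hx hy; apply: dF; [lra|lra|right=> ?; lra].
rewrite [im_contour F x0 x1 (q + s) y1]goursat; [|lra|lra|]; last first.
  by move=> x y hx hy; apply: dF; [lra|lra|right=> ?; lra].
rewrite [im_contour F x0 (p - s) _ _]goursat; [|lra|lra|]; last first.
  by move=> x y hx hy; apply: dF; [lra|lra|left=> ?; lra].
rewrite [im_contour F (p + s) x1 _ _]goursat; [|lra|lra|]; last first.
  by move=> x y hx hy; apply: dF; [lra|lra|left=> ?; lra].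
by rewrite !add0r !addr0.
Qed.

Lemma divcE (X Y t u : R) : (X +i* Y) / (t +i* u) =
  ((X * t + Y * u) / (t ^+ 2 + u ^+ 2)) +i* ((Y * t - X * u) / (t ^+ 2 + u ^+ 2)).
Proof.
have -> : (t +i* u)^-1 = (t / (t ^+ 2 + u ^+ 2)) -i* (u / (t ^+ 2 + u ^+ 2)) by [].
by apply/eqP; rewrite eq_complex/=; apply/andP; split; apply/eqP; ring.
Qed.

(** The real part of (X + i Y) / (t + i u).  On each side of a square of half
    side s, the integrand of [im_contour] for a function close to the Cauchy
    kernel 1 / (w - a) is, up to sign, of this form; hence the common bound. *)
Lemma unit_kernel_bound (s X Y t u : R) : 0 < s -> `|X - 1| <= 1 / 4 ->
  `|Y| <= 1 / 4 -> t = s -> `|u| <= s ->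
  1 / (4 * s) <= (X * t + Y * u) / (t ^+ 2 + u ^+ 2).
Proof.
move=> s0 hX hY -> hu.
have u2 : u ^+ 2 <= s ^+ 2 by move: hu; rewrite ler_norml => /andP[]; nra.
have Yu : `|Y * u| <= 1 / 4 * s by rewrite normrM ler_pM.
have X34 : 3 / 4 <= X by move: hX; rewrite ler_norml => /andP[]; lra.
have s2 : 0 < s ^+ 2 by rewrite exprn_gt0.
have u20 : 0 <= u ^+ 2 by rewrite sqr_ge0.
rewrite ler_pdivlMr; last lra.
apply: (@le_trans _ _ (s / 2)).
  rewrite mulrC ler_pdivlMr; last lra.
  suff : (s ^+ 2 + u ^+ 2) * (1 / (4 * s)) * 2 <= s * 1 by lra.
  have -> : (s ^+ 2 + u ^+ 2) * (1 / (4 * s)) * 2 = (s ^+ 2 + u ^+ 2) / (2 * s).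
    by field; lra.
  by rewrite ler_pdivrMr; [rewrite expr2 in u2 *; lra|lra].
have : 3 / 4 * s <= X * s by rewrite ler_wpM2r// ltW.
move: Yu; rewrite ler_norml => /andP[]; lra.
Qed.

(** The exact value for Z = 1 is 2 pi.  A lower bound is enough, and it survives
    a perturbation of Z: each of the four sides, of length 2 s, contributes at
    least 1/2. *)
Lemma im_contour_kernel_ge F (Z : R[i] -> R[i]) (p q s : R) : 0 < s ->
  (forall w, F w = Z w / (w - (p +i* q))) ->
  (forall w, normc (w - (p +i* q)) <= 2 * s -> normc (Z w - 1) <= 1 / 4) ->
  (forall x y, p - s <= x <= p + s -> q - s <= y <= q + s -> x <> p \/ y <> q ->
     ccontinuous F (x +i* y)) ->
  2 <= im_contour F (p - s) (p + s) (q - s) (q + s).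
Proof.
move=> s0 FE HZ cF.
have HZ' x y : p - s <= x <= p + s -> q - s <= y <= q + s ->
    `|complex.Re (Z (x +i* y)) - 1| <= 1 / 4 /\ `|complex.Im (Z (x +i* y))| <= 1 / 4.
  move=> hx hy; have H : normc (Z (x +i* y) - 1) <= 1 / 4.
    apply: HZ; rewrite (le_trans (normc_le_ReIm _))//=.
    have : `|x - p| <= s by rewrite ler_norml; lra.
    by have : `|y - q| <= s by [rewrite ler_norml; lra]; lra.
  split; first by apply: le_trans H; apply: le_trans (ler_abs_Re _); rewrite raddfB.
  by apply: le_trans H; apply: le_trans (ler_abs_Im _); rewrite raddfB subr0.
have lower (u : R -> R) a b : b - a = 2 * s -> {in `[a, b], continuous u} ->
    {in `[a, b], forall x, 1 / (4 * s) <= u x} -> 1 / 2 <= seg_integral u a b.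
  move=> ba cu hu; have ab : a <= b by lra.
  have -> : 1 / 2 = seg_integral (fun=> 1 / (4 * s)) a b :> R.
    by rewrite seg_cst// ba; field; lra.
  by apply: le_seg => // x _; exact: cvg_cst.
have upper (u : R -> R) a b : b - a = 2 * s -> {in `[a, b], continuous u} ->
    {in `[a, b], forall x, u x <= - (1 / (4 * s))} -> seg_integral u a b <= - (1 / 2).
  move=> ba cu hu; have ab : a <= b by lra.
  have -> : - (1 / 2) = seg_integral (fun=> - (1 / (4 * s))) a b :> R.
    by rewrite seg_cst// ba; field; lra.
  by apply: le_seg => // x _; exact: cvg_cst.
have ZE w : Z w = complex.Re (Z w) +i* complex.Im (Z w) by case: (Z w).
have subE (x y : R) : (x +i* y) - (p +i* q) = (x - p) +i* (y - q) by [].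
have H1 : 1 / 2 <= seg_integral (fun x => complex.Im (F (x +i* (q - s)))) (p - s) (p + s).
  apply: lower; first lra.
    move=> x; rewrite in_itv/= => hx.
    by have [] := ccontinuous_horizontal (cF x (q - s) hx ltac:(lra) ltac:(right=> ?; lra)).
  move=> x; rewrite in_itv/= => hx; have [h1 h2] := HZ' x (q - s) hx ltac:(lra).
  rewrite FE subE ZE divcE /=; set X := complex.Re _ in h1 *; set Y := complex.Im _ in h2 *.
  have := @unit_kernel_bound s X Y s (x - p) s0 h1 h2 erefl
    ltac:(rewrite ler_norml; lra).
  by congr (_ <= _ / _); ring.
have H2 : 1 / 2 <= seg_integral (fun y => complex.Re (F ((p + s) +i* y))) (q - s) (q + s).
  apply: lower; first lra.
    move=> y; rewrite in_itv/= => hy.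
    by have [] := ccontinuous_vertical (cF (p + s) y ltac:(lra) hy ltac:(left=> ?; lra)).
  move=> y; rewrite in_itv/= => hy; have [h1 h2] := HZ' (p + s) y ltac:(lra) hy.
  rewrite FE subE ZE divcE /=; set X := complex.Re _ in h1 *; set Y := complex.Im _ in h2 *.
  have := @unit_kernel_bound s X Y s (y - q) s0 h1 h2 erefl
    ltac:(rewrite ler_norml; lra).
  by congr (_ <= _ / _); ring.
have H3 : seg_integral (fun x => complex.Im (F (x +i* (q + s)))) (p - s) (p + s) <= - (1 / 2).
  apply: upper; first lra.
    move=> x; rewrite in_itv/= => hx.
    by have [] := ccontinuous_horizontal (cF x (q + s) hx ltac:(lra) ltac:(right=> ?; lra)).
  move=> x; rewrite in_itv/= => hx; have [h1 h2] := HZ' x (q + s) hx ltac:(lra).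
  rewrite FE subE ZE divcE /=; set X := complex.Re _ in h1 *; set Y := complex.Im _ in h2 *.
  have := @unit_kernel_bound s X Y s (p - x) s0 h1 h2 erefl
    ltac:(rewrite ler_norml; lra).
  by rewrite lerNr -mulNr; congr (_ <= _ / _); ring.
have H4 : seg_integral (fun y => complex.Re (F ((p - s) +i* y))) (q - s) (q + s) <= - (1 / 2).
  apply: upper; first lra.
    move=> y; rewrite in_itv/= => hy.
    by have [] := ccontinuous_vertical (cF (p - s) y ltac:(lra) hy ltac:(left=> ?; lra)).
  move=> y; rewrite in_itv/= => hy; have [h1 h2] := HZ' (p - s) y ltac:(lra) hy.
  rewrite FE subE ZE divcE /=; set X := complex.Re _ in h1 *; set Y := complex.Im _ in h2 *.
  have := @unit_kernel_bound s X Y s (q - y) s0 h1 h2 erefl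
    ltac:(rewrite ler_norml; lra).
  by rewrite lerNr -mulNr; congr (_ <= _ / _); ring.
by rewrite /im_contour; lra.
Qed.

End cauchy.

(** * Maximum principle and Cauchy's estimate *)

Section cauchy_estimate.
Context {R : realType}.
Local Notation cderive g := (derive1 (g : R[i]^o -> R[i]^o)).
Implicit Types (F G g : R[i] -> R[i]) (z w a B : R[i]).

Definition cderivable G w := exists B, has_cderiv G w B.

Lemma cderivableP G w : cderivable G w <-> derivable (G : R[i]^o -> R[i]^o) (w : R[i]^o) 1.
Proof.
split=> [[B /has_cderivP[]]//|dG].
by exists ('D_1 (G : R[i]^o -> R[i]^o) w); apply/has_cderivP; exact: derivableP.
Qed.

Lemma cderivable_has_cderiv G w : cderivable G w -> has_cderiv G w (cderive G w).
Proof. by move=> /cderivableP dG; apply/has_cderivP; rewrite derive1E; exact: derivableP. Qed.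

Lemma has_cderiv_derive1 G w B : has_cderiv G w B -> cderive G w = B.
Proof. by move=> /has_cderivP[_ <-]; rewrite derive1E. Qed.

Lemma cderivable_cst (c : R[i]) w : cderivable (fun=> c) w.
Proof. by apply/cderivableP; exact: derivable_cst. Qed.

Lemma cderivable_id w : cderivable id w.
Proof. by apply/cderivableP; exact: derivable_id. Qed.

Lemma cderivableB F G w : cderivable F w -> cderivable G w ->
  cderivable (fun z => F z - G z) w.
Proof.
move=> /cderivableP dF /cderivableP dG; apply/cderivableP.
exact: derivableB dF dG.
Qed.

Lemma cderivableM F G w : cderivable F w -> cderivable G w ->
  cderivable (fun z => F z * G z) w.
Proof.
move=> /cderivableP dF /cderivableP dG; apply/cderivableP.
exact: derivableM dF dG.
Qed.

Lemma cderivableV F w : F w != 0 -> cderivable F w -> cderivable (fun z => (F z)^-1) w.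
Proof. by move=> F0 /cderivableP dF; apply/cderivableP; exact: derivableV F0 dF. Qed.

Lemma cderivable_div_sub F (a w : R[i]) : w != a -> cderivable F w ->
  cderivable (fun z => F z / (z - a)) w.
Proof.
move=> wa dF; apply: cderivableM => //.
apply: cderivableV; first by rewrite subr_eq0.
by apply: cderivableB; [exact: cderivable_id|exact: cderivable_cst].
Qed.

(** The integral of F = G / (G(a) (w - a)) is the same over the rectangle and over
    a small square about a = p + i q.  On the square G / G(a) is close to 1, so
    the integral is at least 2; on the rectangle it is at most
    16 max |G| / |G(a)|, because |w - a| >= r there and the sides have length at
    most 4 r.  Mere continuity at a is allowed with a view to difference
    quotients. *)
Lemma max_principle_up_to_constant G (p q r x0 x1 y0 y1 M : R) : 0 < r ->
  p - 2 * r <= x0 <= p - r -> p + r <= x1 <= p + 2 * r ->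
  q - 2 * r <= y0 <= q - r -> q + r <= y1 <= q + 2 * r ->
  (forall x y, x0 <= x <= x1 -> y0 <= y <= y1 -> x <> p \/ y <> q ->
     cderivable G (x +i* y)) ->
  ccontinuous G (p +i* q) ->
  (forall x y, x0 <= x <= x1 -> y0 <= y <= y1 ->
     [\/ x = x0, x = x1, y = y0 | y = y1] -> normc (G (x +i* y)) <= M) ->
  normc (G (p +i* q)) <= 8 * M.
Proof.
move=> r0 hx0 hx1 hy0 hy1 dG cG GM; set a := p +i* q.
have M0 : 0 <= M.
  by apply: le_trans (GM x0 y0 ltac:(lra) ltac:(lra) _); [exact: normc_ge0|constructor 1].
have [Ga0|Ga0] := eqVneq (G a) 0; first by rewrite Ga0 normc0; lra.
have nGa : 0 < normc (G a) by rewrite normc_gt0.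
pose Z w := G w * (G a)^-1.
pose F w := Z w / (w - a).
have dF x y : x0 <= x <= x1 -> y0 <= y <= y1 -> x <> p \/ y <> q -> cderivable F (x +i* y).
  move=> hx hy h; have wa : x +i* y != a by apply/eqP => -[]; case: h.
  exact: cderivable_div_sub wa (cderivableM (dG x y hx hy h) (cderivable_cst _ _)).
have cF x y : x0 <= x <= x1 -> y0 <= y <= y1 -> x <> p \/ y <> q -> ccontinuous F (x +i* y).
  by move=> hx hy h; exact: has_cderiv_ccontinuous (cderivable_has_cderiv (dF x y hx hy h)).
have [d d0 Hd] := cG (normc (G a) / 4) (divr_gt0 nGa (ltr0Sn _ 3)).
pose s := Num.min r (d / 4).
have s0 : 0 < s by rewrite lt_min r0; lra.
have sr : s <= r by rewrite ge_min lexx.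
have sd : s <= d / 4 by rewrite ge_min lexx orbT.
have low : 2 <= im_contour F (p - s) (p + s) (q - s) (q + s).
  apply: (@im_contour_kernel_ge _ F Z) => // [w wa|x y hx hy h]; last by apply: cF; lra.
  rewrite /Z -[1](@mulfV _ (G a))// -mulrBl normcM normcV ler_pdivrMr//.
  by rewrite mulrC ltW// mulrA mulr1; apply: Hd; apply: le_lt_trans wa _; lra.
have FM x y : x0 <= x <= x1 -> y0 <= y <= y1 ->
    [\/ x = x0, x = x1, y = y0 | y = y1] -> normc (F (x +i* y)) <= M / (normc (G a) * r).
  move=> hx hy h; rewrite /F /Z normcM normcV normcM normcV.
  have xa : r <= normc (x +i* y - a).
    case: h => h.
    - by apply: le_trans (ler_abs_Re _); rewrite /= h ler0_norm; lra.
    - by apply: le_trans (ler_abs_Re _); rewrite /= h ger0_norm; lra.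
    - by apply: le_trans (ler_abs_Im _); rewrite /= h ler0_norm; lra.
    - by apply: le_trans (ler_abs_Im _); rewrite /= h ger0_norm; lra.
  rewrite invfM mulrA; apply: ler_pM.
  - by rewrite mulr_ge0 ?invr_ge0 ?normc_ge0.
  - by rewrite invr_ge0 normc_ge0.
  - by rewrite ler_wpM2r ?invr_ge0 ?normc_ge0// GM.
  - by rewrite lef_pV2// posrE; lra.
have side (u : R -> R) b c : c - b <= 4 * r -> b <= c -> {in `[b, c], continuous u} ->
    {in `[b, c], forall x, `|u x| <= M / (normc (G a) * r)} ->
    `|seg_integral u b c| <= 4 * M / normc (G a).
  move=> cb bc cu hu.
  have : `|seg_integral u b c - 0 * (c - b)| <= M / (normc (G a) * r) * (c - b).
    by apply: seg_near => // x xbc; rewrite subr0 hu.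
  rewrite mul0r subr0 => /le_trans; apply.
  apply: (@le_trans _ _ (M / (normc (G a) * r) * (4 * r))).
    by rewrite ler_wpM2l// divr_ge0// mulr_ge0// ltW.
  by rewrite le_eqVlt; apply/orP; left; apply/eqP; field; lra.
have up : `|im_contour F x0 x1 y0 y1| <= 16 * M / normc (G a).
  have h1 : `|seg_integral (fun x => complex.Im (F (x +i* y0))) x0 x1| <= 4 * M / normc (G a).
    apply: side; [lra|lra| |] => x; rewrite in_itv/= => hx.
      by have [] := ccontinuous_horizontal (cF x y0 hx ltac:(lra) ltac:(right=> ?; lra)).
    by apply: le_trans (ler_abs_Im _) (FM _ _ _ _ _); [lra|lra|constructor 3].
  have h2 : `|seg_integral (fun x => complex.Im (F (x +i* y1))) x0 x1| <= 4 * M / normc (G a).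
    apply: side; [lra|lra| |] => x; rewrite in_itv/= => hx.
      by have [] := ccontinuous_horizontal (cF x y1 hx ltac:(lra) ltac:(right=> ?; lra)).
    by apply: le_trans (ler_abs_Im _) (FM _ _ _ _ _); [lra|lra|constructor 4].
  have h3 : `|seg_integral (fun y => complex.Re (F (x0 +i* y))) y0 y1| <= 4 * M / normc (G a).
    apply: side; [lra|lra| |] => y; rewrite in_itv/= => hy.
      by have [] := ccontinuous_vertical (cF x0 y ltac:(lra) hy ltac:(left=> ?; lra)).
    by apply: le_trans (ler_abs_Re _) (FM _ _ _ _ _); [lra|lra|constructor 1].
  have h4 : `|seg_integral (fun y => complex.Re (F (x1 +i* y))) y0 y1| <= 4 * M / normc (G a).
    apply: side; [lra|lra| |] => y; rewrite in_itv/= => hy.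
      by have [] := ccontinuous_vertical (cF x1 y ltac:(lra) hy ltac:(left=> ?; lra)).
    by apply: le_trans (ler_abs_Re _) (FM _ _ _ _ _); [lra|lra|constructor 2].
  move: h1 h2 h3 h4; rewrite /im_contour !ler_norml.
  clear; set k := normc _.
  by do 4 (move=> /andP[? ?]); apply/andP; split; lra.
have E : im_contour F x0 x1 y0 y1 = im_contour F (p - s) (p + s) (q - s) (q + s).
  by apply: im_contour_annulus; [exact: s0|lra|lra|lra|lra|exact: dF].
have : 2 <= 16 * M / normc (G a).
  by apply: (le_trans low); rewrite -E; apply: le_trans up; exact: ler_norm.
by rewrite ler_pdivlMr//; lra.
Qed.

(** The maximum principle is used twice: on g - c, to bound g(a) - c, and on the
    difference quotient of g at a, extended by its limit g'(a).  The constant c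
    lets M measure the oscillation of g along the boundary. *)
Lemma cauchy_estimate g (c : R[i]) (p q r x0 x1 y0 y1 M : R) : 0 < r ->
  p - 2 * r <= x0 <= p - r -> p + r <= x1 <= p + 2 * r ->
  q - 2 * r <= y0 <= q - r -> q + r <= y1 <= q + 2 * r ->
  (forall x y, x0 <= x <= x1 -> y0 <= y <= y1 -> cderivable g (x +i* y)) ->
  (forall x y, x0 <= x <= x1 -> y0 <= y <= y1 ->
     [\/ x = x0, x = x1, y = y0 | y = y1] -> normc (g (x +i* y) - c) <= M) ->
  normc (cderive g (p +i* q)) <= 72 * M / r.
Proof.
move=> r0 hx0 hx1 hy0 hy1 dg gM; set a := p +i* q.
have dga : cderivable g a by apply: dg; lra.
have M0 : 0 <= M.
  by apply: le_trans (gM x0 y0 ltac:(lra) ltac:(lra) _); [exact: normc_ge0|constructor 1].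
have ga : normc (g a - c) <= 8 * M.
  have dgc x y : x0 <= x <= x1 -> y0 <= y <= y1 -> x <> p \/ y <> q ->
      cderivable (fun z => g z - c) (x +i* y).
    by move=> hx hy _; exact: cderivableB (dg x y hx hy) (cderivable_cst c _).
  have cgc := has_cderiv_ccontinuous
    (cderivable_has_cderiv (cderivableB dga (cderivable_cst c a))).
  exact: (max_principle_up_to_constant r0 hx0 hx1 hy0 hy1 dgc cgc gM).
set D := derive1 _ _.
pose G w := if w == a then D else (g w - g a) / (w - a).
have -> : D = G a by rewrite /G eqxx.
(* On the boundary |g - g(a)| <= M + 8 M, hence the quotient is at most 9 M / r. *)
have -> : 72 * M / r = 8 * (9 * M / r) by field; lra.
apply: (max_principle_up_to_constant r0 hx0 hx1 hy0 hy1 (G := G)).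
- move=> x y hx hy h.
  have wa : x +i* y != a by apply/eqP => -[]; case: h.
  have dga' := cderivableB (dg x y hx hy) (cderivable_cst (g a) _).
  have [B dq] := cderivable_div_sub wa dga'; exists B => e /dq[d d0 Hd].
  have n0 : 0 < normc (x +i* y - a) by rewrite normc_gt0 subr_eq0.
  exists (Num.min d (normc (x +i* y - a))); first by rewrite lt_min d0.
  move=> w; rewrite lt_min => /andP[wd wn].
  rewrite /G (negPf wa); case: eqVneq => [wE|_]; last exact: Hd.
  by move: wn; rewrite wE normcB ltxx.
- move=> e e0.
  have [d d0 Hd] := cderivable_has_cderiv dga (divr_gt0 e0 (ltr0Sn _ 1)).
  exists d => // w wd; rewrite /G eqxx; case: eqVneq => [_|wa].
    by rewrite subrr normc0.
  have n0 : 0 < normc (w - a) by rewrite normc_gt0 subr_eq0.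
  apply: (@le_lt_trans _ _ (e / 2)); last lra.
  rewrite -(ler_pM2r n0) -normcM mulrBl divfK ?subr_eq0//.
  exact: Hd.
- move=> x y hx hy h.
  have xa : r <= normc (x +i* y - a).
    case: h => h.
    - by apply: le_trans (ler_abs_Re _); rewrite /= h ler0_norm; lra.
    - by apply: le_trans (ler_abs_Re _); rewrite /= h ger0_norm; lra.
    - by apply: le_trans (ler_abs_Im _); rewrite /= h ler0_norm; lra.
    - by apply: le_trans (ler_abs_Im _); rewrite /= h ger0_norm; lra.
  have wa : x +i* y != a by rewrite -subr_eq0 -normc_gt0; lra.
  rewrite /G (negPf wa) normcM normcV; apply: ler_pM; rewrite ?invr_ge0 ?normc_ge0//.
    have -> : g (x +i* y) - g a = (g (x +i* y) - c) - (g a - c) by ring.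
    apply: (le_trans (le_normcD _ _)); rewrite normcN.
    by have := gM x y hx hy h; lra.
  by rewrite lef_pV2// posrE; lra.
Qed.

End cauchy_estimate.

(** * Continuity of the derivative and increments along segments *)

Section increments.
Context {R : realType}.
Local Notation cderive g := (derive1 (g : R[i]^o -> R[i]^o)).
Implicit Types (F G g : R[i] -> R[i]) (z w a B : R[i]).

Lemma has_cderiv_sub_linear g (c a z B : R[i]) : has_cderiv g z B ->
  has_cderiv (fun w => g w - c * (w - a)) z (B - c).
Proof.
move=> dg e /dg[d d0 Hd]; exists d => // w /Hd.
suff -> : g w - c * (w - a) - (g z - c * (z - a)) - (B - c) * (w - z) =
  g w - g z - B * (w - z) by [].
by ring.
Qed.

(** Differentiability at a says that g1(w) = g(w) - g'(a) (w - a) varies by at most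
    e' |w - a|.  Cauchy's estimate for g1 on a square about z, of size |z - a|,
    turns this into |g'(z) - g'(a)| <= C e'. *)
Lemma derive1_ccontinuous g a (r : R) : 0 < r ->
  (forall w, normc (w - a) < r -> cderivable g w) ->
  ccontinuous (cderive g) a.
Proof.
move=> r0 dg e e0.
have dga : cderivable g a by apply: dg; rewrite subrr normc0.
have dD z : cderivable g z -> has_cderiv g z (cderive g z).
  exact: cderivable_has_cderiv.
move DE : (derive1 _) dD => D dD.
(* Any number above 72 * 3 would do for 433: the remainder is at most
   e / 433 * 3 |z - a| on the square, and Cauchy's estimate costs a factor 72. *)
have [d d0 Hd] := dD a dga _ (divr_gt0 e0 (ltr0Sn _ 432)).
exists (Num.min d r / 4) => [|z]; first by rewrite divr_gt0// lt_min d0.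
rewrite ltr_pdivlMr// lt_min => /andP[zd zr].
have [->|za] := eqVneq z a; first by rewrite subrr normc0.
set t := normc (z - a) in zd zr *; have t0 : 0 < t by rewrite normc_gt0 subr_eq0.
pose g1 w := g w - D a * (w - a).
have dgz : cderivable g z by apply: dg; rewrite -/t; lra.
have dg1 : cderive g1 z = D z - D a.
  exact: has_cderiv_derive1 (has_cderiv_sub_linear (D a) a (dD z dgz)).
rewrite -dg1; case zE : z => [p q].
have near_sq x y : p - t <= x <= p + t -> q - t <= y <= q + t ->
    normc (x +i* y - a) <= 3 * t.
  move=> hx hy; have -> : x +i* y - a = (x +i* y - z) + (z - a) by ring.
  apply: (le_trans (le_normcD _ _)); rewrite -/t.
  suff : normc (x +i* y - z) <= 2 * t by lra.
  rewrite (le_trans (normc_le_ReIm _))// zE/=.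
  have : `|x - p| <= t by rewrite ler_norml; lra.
  by have : `|y - q| <= t by [rewrite ler_norml; lra]; lra.
have ce := @cauchy_estimate R g1 (g a) p q t (p - t) (p + t) (q - t) (q + t)
  (e / 433%:R * (3 * t)) t0.
apply: le_lt_trans (ce _ _ _ _ _ _) _; try lra.
- move=> x y hx hy; have := near_sq x y hx hy => h.
  apply: cderivableB; first by apply: dg; lra.
  apply: cderivableM; first exact: cderivable_cst.
  by apply: cderivableB; [exact: cderivable_id|exact: cderivable_cst].
- move=> x y hx hy _; have := near_sq x y hx hy => h.
  have -> : g1 (x +i* y) - g a = g (x +i* y) - g a - D a * (x +i* y - a).
    by rewrite /g1; ring.
  apply: (le_trans (Hd _ _)); first by lra.
  by apply: ler_wpM2l h; apply: divr_ge0; [exact: ltW|exact: ler0n].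
- have -> : 72 * (e / 433%:R * (3 * t)) / t = e * (216 / 433) by field; lra.
  by lra.
Qed.

Lemma real_is_derive (u : R -> R) (x k : R) :
  (forall e, 0 < e -> exists2 d, 0 < d & forall t, `|t - x| < d ->
     `|u t - u x - k * (t - x)| <= e * `|t - x|) -> is_derive x 1 u k.
Proof.
move=> H.
have cv : (fun h : R => h^-1 *: (u (h *: (1 : R) + x) - u x)) @ 0^' --> k.
  apply/cvgrPdist_le => e e0.
  have [d d0 Hd] := H _ e0.
  rewrite near_withinE; apply/nbhs_ballP; exists d => //= h.
  rewrite /ball/= sub0r normrN => hd h0.
  have nh : 0 < `|h| by rewrite normr_gt0.
  rewrite -(ler_pM2r nh) -normrM mulrBl [_ *: 1]mulr1 mulrC [_ *: (_ - _)]mulrC.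
  rewrite mulrVK ?unitfE// distrC mulrC.
  by have := Hd (h + x); rewrite addrK [k * h]mulrC; apply.
by split; [apply/cvg_ex; exists k|apply: cvg_lim].
Qed.

Lemma vertical_derive g x y : cderivable g (x +i* y) ->
  let D := cderive g (x +i* y) in
  is_derive y 1 (fun t => complex.Re (g (x +i* t))) (- complex.Im D) /\
  is_derive y 1 (fun t => complex.Im (g (x +i* t))) (complex.Re D).
Proof.
move=> dg D; have vert t : (x +i* t) - (x +i* y) = 0 +i* (t - y).
  by apply/eqP; rewrite eq_complex/= subrr !eqxx.
have norm_vert (t : R) : normc (0 +i* t) = `|t|.
  by rewrite /= expr0n/= add0r sqrtr_sqr.
split; apply: real_is_derive => e /(cderivable_has_cderiv dg)[d d0 Hd]; exists d => // t ty.
  have := Hd (x +i* t); rewrite vert norm_vert => /(_ ty); apply: le_trans.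
  apply: le_trans (ler_abs_Re _); rewrite -/D.
  by case: D (g _) (g _) => [D1 D2] [u1 u2] [v1 v2] /=; rewrite mulr0 sub0r mulNr.
have := Hd (x +i* t); rewrite vert norm_vert => /(_ ty); apply: le_trans.
apply: le_trans (ler_abs_Im _); rewrite -/D.
by case: D (g _) (g _) => [D1 D2] [u1 u2] [v1 v2] /=; rewrite mulr0 addr0.
Qed.

Lemma horizontal_derive g x y : cderivable g (x +i* y) ->
  let D := cderive g (x +i* y) in
  is_derive x 1 (fun t => complex.Re (g (t +i* y))) (complex.Re D) /\
  is_derive x 1 (fun t => complex.Im (g (t +i* y))) (complex.Im D).
Proof.
move=> dg D; have horz t : (t +i* y) - (x +i* y) = (t - x) +i* 0.
  by apply/eqP; rewrite eq_complex/= subrr !eqxx.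
have norm_horz (t : R) : normc (t +i* 0) = `|t|.
  by rewrite /= expr0n/= addr0 sqrtr_sqr.
split; apply: real_is_derive => e /(cderivable_has_cderiv dg)[d d0 Hd]; exists d => // t ty.
  have := Hd (t +i* y); rewrite horz norm_horz => /(_ ty); apply: le_trans.
  apply: le_trans (ler_abs_Re _); rewrite -/D.
  by case: D (g _) (g _) => [D1 D2] [u1 u2] [v1 v2] /=; rewrite mulr0 subr0.
have := Hd (t +i* y); rewrite horz norm_horz => /(_ ty); apply: le_trans.
apply: le_trans (ler_abs_Im _); rewrite -/D.
by case: D (g _) (g _) => [D1 D2] [u1 u2] [v1 v2] /=; rewrite mulr0 add0r.
Qed.

Lemma increment_le (u v k : R -> R) (c d : R) :
  {in `[c, d], continuous v} -> {in `[c, d], continuous k} ->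
  {in `[c, d], forall x : R, is_derive x 1 u (v x)} ->
  {in `[c, d], forall x, `|v x| <= k x} ->
  {in `[c, d] &, forall x y, `|u x - u y| <= seg_integral k c d}.
Proof.
move=> cv ck du vk x y; wlog xy : x y / x <= y.
  move=> H hx hy; have [/H|/ltW/H] := leP x y; first exact.
  by rewrite distrC; apply.
rewrite !in_itv/= => hx hy; rewrite distrC.
have sub (t a b : R) : t \in `[a, b] -> c <= a -> b <= d -> t \in `[c, d].
  by rewrite !in_itv/=; lra.
have k0 : {in `[c, d], forall x, 0 <= k x}.
  by move=> t /vk; apply: le_trans.
have seg0 (a b : R) : c <= a -> b <= d -> 0 <= seg_integral k a b.
  move=> ca bd; apply: Rintegral_ge0 => t /= tab.
  by apply: k0; exact: sub tab ca bd.
rewrite -(@seg_ftc R v u x y)//; [|by move=> t /sub h; apply: cv; apply: h; lra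
  |by move=> t /sub h; apply: du; apply: h; lra].
have sxy t : t \in `[x, y] -> t \in `[c, d] by move/sub; apply; lra.
have vkxy : `|seg_integral v x y| <= seg_integral k x y.
  rewrite ler_norml; apply/andP; split; last first.
    apply: le_seg => t /sxy ht; [exact: cv|exact: ck|].
    exact: le_trans (ler_norm _) (vk t ht).
  have -> : - seg_integral k x y = seg_integral (fun t => 0 - k t) x y.
    rewrite (@segB R (fun=> 0) k) ?seg_cst ?mul0r ?sub0r// => t /sxy ht.
      exact: cvg_cst.
    exact: ck.
  apply: le_seg => t /sxy ht.
  - by apply: cvgB; [exact: cvg_cst|exact: ck].
  - exact: cv.
  - by rewrite sub0r lerNl; apply: le_trans (vk t ht); rewrite -normrN ler_norm.
apply: (le_trans vkxy).
rewrite (@seg_split R k c x d)//; [|lra|lra].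
rewrite (@seg_split R k x y d)//; [|lra|]; last first.
  by move=> t /sub h; apply: ck; apply: h; lra.
have := seg0 c x ltac:(lra) ltac:(lra).
by have := seg0 y d ltac:(lra) ltac:(lra); lra.
Qed.

Lemma ccontinuous_normc F z : ccontinuous F z -> forall e, 0 < e ->
  exists2 d, 0 < d & forall w, normc (w - z) < d -> `|normc (F w) - normc (F z)| < e.
Proof.
move=> cF e /cF[d d0 Hd]; exists d => // w /Hd; apply: le_lt_trans.
have h1 := le_normcD (F w - F z) (F z); rewrite subrK in h1.
have h2 := le_normcD (F z - F w) (F w); rewrite subrK normcB in h2.
by rewrite ler_norml; lra.
Qed.

Lemma normc_continuous_vertical F x y : ccontinuous F (x +i* y) ->
  {for y, continuous (fun t => normc (F (x +i* t)))}.
Proof.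
move=> /ccontinuous_normc cF; apply/cvgrPdist_lt => e /cF[d d0 H]; near=> t.
rewrite distrC; apply: H.
rewrite (le_lt_trans (normc_le_ReIm _))//= subrr normr0 add0r distrC; near: t.
exact: cvgr_dist_lt.
Unshelve. all: by end_near. Qed.

Lemma normc_continuous_horizontal F x y : ccontinuous F (x +i* y) ->
  {for x, continuous (fun t => normc (F (t +i* y)))}.
Proof.
move=> /ccontinuous_normc cF; apply/cvgrPdist_lt => e /cF[d d0 H]; near=> t.
rewrite distrC; apply: H.
rewrite (le_lt_trans (normc_le_ReIm _))//= subrr normr0 addr0 distrC; near: t.
exact: cvgr_dist_lt.
Unshelve. all: by end_near. Qed.

Lemma vertical_increment g (x c d : R) :
  {in `[c, d], forall y, cderivable g (x +i* y) /\
     ccontinuous (cderive g) (x +i* y)} ->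
  {in `[c, d] &, forall y y', normc (g (x +i* y) - g (x +i* y')) <=
     2 * seg_integral (fun t => normc (cderive g (x +i* t))) c d}.
Proof.
move=> H y y' hy hy'; set k := fun t => _.
have ck : {in `[c, d], continuous k}.
  by move=> t /H[_]; exact: normc_continuous_vertical.
apply: (le_trans (normc_le_ReIm _)); rewrite !raddfB.
have h1 := @increment_le (fun t => complex.Re (g (x +i* t)))
  (fun t => - complex.Im (cderive g (x +i* t))) k c d.
have h2 := @increment_le (fun t => complex.Im (g (x +i* t)))
  (fun t => complex.Re (cderive g (x +i* t))) k c d.
have {}h1 : `|complex.Re (g (x +i* y)) - complex.Re (g (x +i* y'))| <= seg_integral k c d.
  apply: h1 hy hy' => // t ht; have [gt dt] := H t ht.
  - by apply: cvgN; have [] := ccontinuous_vertical dt.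
  - by have [] := vertical_derive gt.
  - by rewrite normrN; exact: ler_abs_Im.
have {}h2 : `|complex.Im (g (x +i* y)) - complex.Im (g (x +i* y'))| <= seg_integral k c d.
  apply: h2 hy hy' => // t ht; have [gt dt] := H t ht.
  - by have [] := ccontinuous_vertical dt.
  - by have [] := vertical_derive gt.
  - exact: ler_abs_Re.
by lra.
Qed.

Lemma horizontal_increment g (y c d : R) :
  {in `[c, d], forall x, cderivable g (x +i* y) /\
     ccontinuous (cderive g) (x +i* y)} ->
  {in `[c, d] &, forall x x', normc (g (x +i* y) - g (x' +i* y)) <=
     2 * seg_integral (fun t => normc (cderive g (t +i* y))) c d}.
Proof.
move=> H x x' hx hx'; set k := fun t => _.
have ck : {in `[c, d], continuous k}.
  by move=> t /H[_]; exact: normc_continuous_horizontal.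
apply: (le_trans (normc_le_ReIm _)); rewrite !raddfB.
have h1 := @increment_le (fun t => complex.Re (g (t +i* y)))
  (fun t => complex.Re (cderive g (t +i* y))) k c d.
have h2 := @increment_le (fun t => complex.Im (g (t +i* y)))
  (fun t => complex.Im (cderive g (t +i* y))) k c d.
have {}h1 : `|complex.Re (g (x +i* y)) - complex.Re (g (x' +i* y))| <= seg_integral k c d.
  apply: h1 hx hx' => // t ht; have [gt dt] := H t ht.
  - by have [] := ccontinuous_horizontal dt.
  - by have [] := horizontal_derive gt.
  - exact: ler_abs_Re.
have {}h2 : `|complex.Im (g (x +i* y)) - complex.Im (g (x' +i* y))| <= seg_integral k c d.
  apply: h2 hx hx' => // t ht; have [gt dt] := H t ht.
  - by have [] := ccontinuous_horizontal dt.
  - by have [] := horizontal_derive gt.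
  - exact: ler_abs_Im.
by lra.
Qed.

End increments.

(** * Rectangles with controlled sides *)

Section slices.
Context {R : realType}.
Local Notation cderive g := (derive1 (g : R[i]^o -> R[i]^o)).
Implicit Types (F G g : R[i] -> R[i]).
Notation mu := (@lebesgue_measure R).

(** Any boundary point is joined to the corner x0 + i y0 by at most two sides, so
    g differs from its value there by at most 2 T + 2 T. *)
Lemma derive1_side_integrals g D (p q r x0 x1 y0 y1 T : R) : 0 < r ->
  cderive g = D ->
  p - 2 * r <= x0 <= p - r -> p + r <= x1 <= p + 2 * r ->
  q - 2 * r <= y0 <= q - r -> q + r <= y1 <= q + 2 * r ->
  (forall x y, x0 <= x <= x1 -> y0 <= y <= y1 ->
     cderivable g (x +i* y) /\ ccontinuous D (x +i* y)) ->
  seg_integral (fun y => normc (D (x0 +i* y))) y0 y1 <= T ->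
  seg_integral (fun y => normc (D (x1 +i* y))) y0 y1 <= T ->
  seg_integral (fun x => normc (D (x +i* y0))) x0 x1 <= T ->
  seg_integral (fun x => normc (D (x +i* y1))) x0 x1 <= T ->
  normc (D (p +i* q)) <= 288 * T / r.
Proof.
move=> r0 DE hx0 hx1 hy0 hy1 dg T1 T2 T3 T4.
have -> : 288 * T / r = 72 * (4 * T) / r by field; lra.
have V x : x0 <= x <= x1 ->
    {in `[y0, y1], forall y, cderivable g (x +i* y) /\ ccontinuous D (x +i* y)}.
  by move=> hx y; rewrite in_itv/= => hy; exact: dg.
have H y : y0 <= y <= y1 ->
    {in `[x0, x1], forall x, cderivable g (x +i* y) /\ ccontinuous D (x +i* y)}.
  by move=> hy x; rewrite in_itv/= => hx; exact: dg.
have V' := V; have H' := H; rewrite -DE in V' H'.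
have yy : y0 \in `[y0, y1] by rewrite in_itv/=; lra.
have xx : x0 \in `[x0, x1] by rewrite in_itv/=; lra.
have xx1 : x1 \in `[x0, x1] by rewrite in_itv/=; lra.
have yy1 : y1 \in `[y0, y1] by rewrite in_itv/=; lra.
have T0 : 0 <= T.
  by apply: le_trans T1; apply: Rintegral_ge0 => y _; exact: normc_ge0.
rewrite -DE; apply: (cauchy_estimate (c := g (x0 +i* y0)) r0 hx0 hx1 hy0 hy1)
  => [x y hx hy|].
  by have [] := dg x y hx hy.
move=> x y hx hy; have yI : y \in `[y0, y1] by rewrite in_itv.
have xI : x \in `[x0, x1] by rewrite in_itv.
case=> ->.
- have := @vertical_increment _ g x0 y0 y1 (V' x0 ltac:(lra)) y y0 yI yy.
  by rewrite DE; lra.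
- have -> : g (x1 +i* y) - g (x0 +i* y0) =
    (g (x1 +i* y) - g (x1 +i* y0)) + (g (x1 +i* y0) - g (x0 +i* y0)) by ring.
  apply: (le_trans (le_normcD _ _)).
  have := @vertical_increment _ g x1 y0 y1 (V' x1 ltac:(lra)) y y0 yI yy.
  have := @horizontal_increment _ g y0 x0 x1 (H' y0 ltac:(lra)) x1 x0 xx1 xx.
  by rewrite DE; lra.
- have := @horizontal_increment _ g y0 x0 x1 (H' y0 ltac:(lra)) x x0 xI xx.
  by rewrite DE; lra.
- have -> : g (x +i* y1) - g (x0 +i* y0) =
    (g (x +i* y1) - g (x0 +i* y1)) + (g (x0 +i* y1) - g (x0 +i* y0)) by ring.
  apply: (le_trans (le_normcD _ _)).
  have := @vertical_increment _ g x0 y0 y1 (V' x0 ltac:(lra)) y1 y0 yy1 yy.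
  have := @horizontal_increment _ g y1 x0 x1 (H' y1 ltac:(lra)) x x0 xI xx.
  by rewrite DE; lra.
Qed.

(** The bound on N, integrated over a segment of length at most 4 r, gives
    r (integral of N) <= 4 r + r^2 (I + 1) / r. *)
Lemma seg_le_slice (N : R -> R) (K : R -> \bar R) (c d r I : R) : 0 < r ->
  c <= d -> d - c <= 4 * r -> 0 <= I ->
  {in `[c, d], continuous N} -> (forall y, 0 <= N y) ->
  measurable_fun setT K -> (forall y, 0 <= K y)%E ->
  {in `[c, d], forall y, (r * N y)%:E <= 1 + (r ^+ 2)%:E * K y}%E ->
  (\int[mu]_y K y <= ((I + 1) / r)%:E)%E ->
  seg_integral N c d <= I + 5.
Proof.
move=> r0 cd dc I0 cN N0 mK K0 NK KI.
have iN := seg_integrable cN.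
have mN : measurable_fun `[c, d] (EFin \o N) by exact: measurable_int iN.
have mJ : measurable (`[c, d]%classic : set R) by exact: measurable_itv.
have mKJ : measurable_fun `[c, d] K by exact: measurable_funS mK.
have segE : (seg_integral N c d)%:E = (\int[mu]_(y in `[c, d]) (N y)%:E)%E.
  by rewrite /seg_integral /Rintegral fineK//; exact: integrable_fin_num.
rewrite -(ler_pM2l r0) -lee_fin EFinM segE -ge0_integralZl//; last 2 first.
  by move=> y _; rewrite lee_fin.
  by rewrite lee_fin ltW.
apply: (@le_trans _ _ (\int[mu]_(y in `[c, d]) (cst 1 y + (r ^+ 2)%:E * K y))%E).
  apply: ge0_le_integral => //.
  - by move=> y _; rewrite -EFinM lee_fin mulr_ge0// ltW.
  - exact: measurable_funeM.
  - by apply: emeasurable_funD; [exact: measurable_cst|exact: measurable_funeM].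
rewrite ge0_integralD//; last 2 first.
  - by move=> y _; rewrite mule_ge0// lee_fin sqr_ge0.
  - exact: measurable_funeM.
rewrite integral_cst// ge0_integralZl//; last by rewrite lee_fin sqr_ge0.
have -> : (r * (I + 5)) = (4 * r) + r ^+ 2 * ((I + 1) / r) by field; lra.
rewrite EFinD; apply: leeD.
  rewrite mul1e /= lebesgue_measure_itv/= lte_fin; case: ifP => _.
    by rewrite -EFinB lee_fin.
  by rewrite lee_fin; lra.
rewrite (EFinM (r ^+ 2)); apply: lee_wpmul2l; first by rewrite lee_fin sqr_ge0.
by apply: le_trans KI; exact: ge0_subset_integral.
Qed.

(** Markov's inequality on an interval of length r; with I + 1 in place of I the
    assumption that no such x exists is refuted by a strict inequality. *)
Lemma good_slice (F : R -> \bar R) (s r I : R) : 0 < r -> 0 <= I ->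
  measurable_fun setT F -> (forall x, 0 <= F x)%E ->
  (\int[mu]_x F x <= I%:E)%E ->
  exists2 x, s <= x <= s + r & (F x <= ((I + 1) / r)%:E)%E.
Proof.
move=> r0 I0 mF F0 FI; apply: contrapT => Hn.
have big x : s <= x <= s + r -> (((I + 1) / r)%:E <= F x)%E.
  by move=> hx; rewrite leNgt; apply/negP => /ltW h; apply: Hn; exists x.
have q0 : 0 <= (I + 1) / r by rewrite divr_ge0// ?ltW//; lra.
have mI : measurable (`[s, s + r]%classic : set R) by exact: measurable_itv.
have mFI : measurable_fun `[s, s + r] F by exact: measurable_funS mF.
have : (\int[mu]_(x in `[s, (s + r)%R]) cst ((I + 1) / r)%:E x <= I%:E)%E.
  apply: le_trans FI; apply: (@le_trans _ _ (\int[mu]_(x in `[s, (s + r)%R]) F x)%E).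
    by apply: ge0_le_integral => // x; rewrite ?lee_fin// in_itv/=; exact: big.
  exact: ge0_subset_integral.
rewrite integral_cst//= lebesgue_measure_itv/= lte_fin ltrDl r0 -EFinB -EFinM lee_fin.
have -> : (I + 1) / r * (s + r - s) = I + 1 by field; lra.
by lra.
Qed.

Lemma area_integralE (K : R * R -> \bar R) :
  measurable_fun setT K -> (forall w, 0 <= K w)%E ->
  (\int[area_measure]_w K w = \int[mu]_x \int[mu]_y K (x, y))%E.
Proof. by move=> mK K0; exact: (@fubini_tonelli1 _ _ _ _ R mu mu K mK K0). Qed.

Lemma good_vertical_line (K : R * R -> \bar R) (s r I : R) : 0 < r -> 0 <= I ->
  measurable_fun setT K -> (forall w, 0 <= K w)%E ->
  (\int[area_measure]_w K w <= I%:E)%E ->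
  exists2 x, s <= x <= s + r & (\int[mu]_y K (x, y) <= ((I + 1) / r)%:E)%E.
Proof.
move=> r0 I0 mK K0; rewrite area_integralE//.
apply: good_slice => //;
  first exact: (@measurable_fun_fubini_tonelli_F _ _ _ _ R mu K mK K0).
by move=> x; apply: integral_ge0.
Qed.

Lemma good_horizontal_line (K : R * R -> \bar R) (s r I : R) : 0 < r -> 0 <= I ->
  measurable_fun setT K -> (forall w, 0 <= K w)%E ->
  (\int[area_measure]_w K w <= I%:E)%E ->
  exists2 y, s <= y <= s + r & (\int[mu]_x K (x, y) <= ((I + 1) / r)%:E)%E.
Proof.
move=> r0 I0 mK K0; rewrite area_integralE//.
rewrite (@fubini_tonelli _ _ _ _ _ mu mu K mK K0).
apply: good_slice => //;
  first exact: (@measurable_fun_fubini_tonelli_G _ _ _ _ R mu K mK K0).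
by move=> x; apply: integral_ge0.
Qed.

(** The product sigma-algebra on the plane contains the open sets: these are
    countable unions of boxes with rational corners. *)
Lemma box_open_measurable (A : set (R * R)) :
  (forall x y, A (x, y) -> exists2 d, 0 < d &
     forall x' y', `|x' - x| < d -> `|y' - y| < d -> A (x', y')) ->
  measurable A.
Proof.
move=> Ao.
pose box (q : rat * rat * rat * rat) : set (R * R) :=
  `]ratr q.1.1.1, ratr q.1.1.2[ `*` `]ratr q.1.2, ratr q.2[.
have -> : A = \bigcup_(q in [set q | box q `<=` A]) box q.
  apply/seteqP; split=> [[x y] Axy|w [q]/=]; last by move=> /(_ w).
  have [d d0 Ad] := Ao x y Axy.
  have [a] := @rat_in_itvoo R (x - d) x ltac:(lra).
  have [b] := @rat_in_itvoo R x (x + d) ltac:(lra).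
  have [c] := @rat_in_itvoo R (y - d) y ltac:(lra).
  have [e] := @rat_in_itvoo R y (y + d) ltac:(lra).
  rewrite !in_itv/= => /andP[e1 e2] /andP[c1 c2] /andP[b1 b2] /andP[a1 a2].
  exists (a, b, c, e); last by split; rewrite /= in_itv/=; apply/andP.
  move=> [x' y'] [] /=; rewrite !in_itv/= => hx hy.
  by apply: Ad; rewrite ltr_norml; lra.
rewrite bigcup_mkcond; apply: countable_bigcupT_measurable => // q; case: ifP => // _.
by apply: measurableX; exact: measurable_itv.
Qed.

End slices.

(** * The Bloch seminorm of a Besov function *)

Section bloch.
Context {R : realType}.
Local Notation cderive g := (derive1 (g : R[i]^o -> R[i]^o)).
Implicit Types (F G g : R[i] -> R[i]) (h : R * R -> R) (A : set (R * R)).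
Notation mu := (@lebesgue_measure R).

Lemma box_open_measurable_fun A h :
  (forall x y, A (x, y) -> exists2 d, 0 < d &
     forall x' y', `|x' - x| < d -> `|y' - y| < d -> A (x', y')) ->
  (forall x y, A (x, y) -> forall e, 0 < e -> exists2 d, 0 < d &
     forall x' y', `|x' - x| < d -> `|y' - y| < d ->
       `|h (x', y') - h (x, y)| < e) ->
  measurable_fun A h.
Proof.
move=> Ao hc; apply: (measurability _ (RGenOInfty.measurableE R)).
move=> _ [_ [c ->] <-]; apply: box_open_measurable => x y [Axy /=].
rewrite in_itv/= andbT => chxy.
have [d1 d10 H1] := Ao x y Axy.
have [d2 d20 H2] := hc x y Axy (h (x, y) - c) ltac:(lra).
exists (Num.min d1 d2); first by rewrite lt_min d10.
move=> x' y'; rewrite !lt_min => /andP[x1 x2] /andP[y1 y2]; split; first exact: H1.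
rewrite /= in_itv/= andbT; have := H2 x' y' x2 y2.
by rewrite ltr_norml; lra.
Qed.

Lemma diskE (z : R[i]) : disk z <-> normc z < 1.
Proof. by rewrite /disk /= normr_normc ltcR. Qed.

Lemma disk_box_open (x y : R) : disk_xy (x, y) -> exists2 d, 0 < d &
  forall x' y' : R, `|x' - x| < d -> `|y' - y| < d -> disk_xy (x', y').
Proof.
move=> /diskE /= xy1; exists ((1 - normc (x +i* y)) / 2); first by rewrite /=; lra.
move=> x' y' hx hy; apply/diskE; rewrite [X in normc X]/=.
have -> : x' +i* y' = (x' +i* y' - (x +i* y)) + (x +i* y) by rewrite subrK.
apply: (le_lt_trans (le_normcD _ _)).
have := normc_le_ReIm (x' +i* y' - (x +i* y)); rewrite [complex.Re _]/= [complex.Im _]/=.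
by move: hx hy xy1; set n := normc (x +i* y); rewrite -/n; lra.
Qed.

Lemma measurable_disk_xy : measurable (@disk_xy R).
Proof. by apply: box_open_measurable; exact: disk_box_open. Qed.

Lemma ccontinuous_measurable_normc F :
  (forall z, disk z -> ccontinuous F z) ->
  measurable_fun (@disk_xy R) (fun w => normc (F (w.1 +i* w.2))).
Proof.
move=> cF; apply: box_open_measurable_fun; first exact: disk_box_open.
move=> x y xyD e e0 /=; have [d d0 Hd] := ccontinuous_normc (cF _ xyD) e0.
exists (d / 2); first lra.
move=> x' y' hx hy; apply: Hd; apply: (le_lt_trans (normc_le_ReIm _)) => /=.
by move: hx hy; lra.
Qed.

Lemma ccontinuous_id (z : R[i]) : ccontinuous id z.
Proof. by move=> e e0; exists e. Qed.

Lemma disk_nbhs (z : R[i]) : disk z ->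
  0 < 1 - normc z /\ forall w, normc (w - z) < 1 - normc z -> disk w.
Proof.
move=> /diskE zD; split=> [|w wz]; first lra.
apply/diskE; have := le_normcD (w - z) z; rewrite subrK; lra.
Qed.

Lemma disk_derive1_ccontinuous g : (forall z, disk z -> cderivable g z) ->
  forall z, disk z -> ccontinuous (cderive g) z.
Proof.
move=> dg z /disk_nbhs[r0 Hr]; apply: derive1_ccontinuous r0 _ => w /Hr; exact: dg.
Qed.

Definition besov_weight (p : R) g (w : R * R) : R :=
  normc (cderive g (w.1 +i* w.2)) `^ p *
  (1 - normc (w.1 +i* w.2) ^+ 2) `^ (p - 2).

Lemma measurable_besov_weight p g : (forall z, disk z -> cderivable g z) ->
  measurable_fun (@disk_xy R) (besov_weight p g).
Proof.
move=> dg; apply: measurable_funM.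
  apply: (measurableT_comp (measurable_powR p)).
  exact: ccontinuous_measurable_normc (disk_derive1_ccontinuous dg).
apply: (measurableT_comp (measurable_powR (p - 2))).
apply: measurable_funB; first exact: measurable_cst.
apply: measurable_funX.
exact: (@ccontinuous_measurable_normc id (fun z _ => @ccontinuous_id z)).
Qed.

(** With t = r N this is t <= 1 + t^p, where r^(p - 2) <= W^(p - 2) since
    p >= 2.  It replaces Holder's inequality: the bound on the integral of N need
    not be homogeneous. *)
Lemma le_one_add_weight (p r N W : R) : 2 <= p -> 0 < r -> 0 <= N -> r <= W ->
  r * N <= 1 + r ^+ 2 * (N `^ p * W `^ (p - 2)).
Proof.
move=> p2 r0 N0 rW.
have rhs0 : 0 <= r ^+ 2 * (N `^ p * W `^ (p - 2)).
  by rewrite mulr_ge0 ?sqr_ge0// mulr_ge0 ?powR_ge0.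
have [t1|/ltW t1] := leP (r * N) 1; first lra.
have t0 : 0 <= r * N by lra.
have h1 : r * N <= (r * N) `^ p.
  by rewrite -[leLHS]powRr1//; apply: ler_powR => //; lra.
have h2 : (r * N) `^ p = r ^+ 2 * (N `^ p * r `^ (p - 2)).
  have -> : p = 2%:R + (p - 2) by ring.
  rewrite powRM ?(ltW r0)//; rewrite [X in X * _]powRD; last first.
    by apply/implyP => _; rewrite gt_eqF.
  rewrite powR_mulrn ?(ltW r0)//; have -> : 2%:R + (p - 2) - 2 = p - 2 by ring.
  by ring.
have h3 : r ^+ 2 * (N `^ p * r `^ (p - 2)) <= r ^+ 2 * (N `^ p * W `^ (p - 2)).
  rewrite ler_wpM2l ?sqr_ge0// ler_wpM2l ?powR_ge0//.
  by apply: ge0_ler_powR; rewrite ?nnegrE; lra.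
lra.
Qed.

(** Put r = (1 - |z|) / 8.  The square of half side 2 r about z stays in the disc
    at distance at least 4 r from the circle, so [le_one_add_weight] applies on
    it with W = 1 - |w|^2.  Each strip of width r along its four edges contains
    a line on which the Besov integrand has integral at most (I + 1) / r, and
    the four lines bound a rectangle to which [derive1_side_integrals]
    applies. *)
Lemma bloch_estimate (p I : R) g : 2 <= p -> 0 <= I ->
  (forall z, disk z -> cderivable g z) -> (besov_integral p g <= I%:E)%E ->
  forall z, disk z ->
    normc (cderive g z) * (1 - normc z) <= 2304 * (I + 5).
Proof.
move=> p2 I0 dg gI z zD; have z1 := zD; move/diskE in z1.
have cD := disk_derive1_ccontinuous dg.
pose K := (EFin \o besov_weight p g) \_ (@disk_xy R).
have mK : measurable_fun setT K.
  apply/(measurable_restrictT _ measurable_disk_xy).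
  by apply/measurable_EFinP; exact: measurable_besov_weight.
have K0 w : (0 <= K w)%E.
  by rewrite /K patchE; case: ifP => // _; rewrite lee_fin mulr_ge0 ?powR_ge0.
have KI : (\int[area_measure]_w K w <= I%:E)%E.
  by apply: le_trans gI; rewrite /besov_integral [leRHS]integral_mkcond.
clear gI.
move DE : (derive1 _) cD => D cD.
have [a1 [a2 zE]] : exists a1 a2, z = a1 +i* a2 by case: (z) => a b; exists a, b.
pose r := (1 - normc z) / 8; have r0 : 0 < r by rewrite /r; lra.
have box x y : a1 - 2 * r <= x <= a1 + 2 * r -> a2 - 2 * r <= y <= a2 + 2 * r ->
    normc (x +i* y) <= 1 - 4 * r.
  move=> hx hy; have := le_normcD (x +i* y - z) z; rewrite subrK.
  have := normc_le_ReIm (x +i* y - z); rewrite zE [complex.Re _]/= [complex.Im _]/= -zE.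
  have : `|x - a1| <= 2 * r by rewrite ler_norml; lra.
  have : `|y - a2| <= 2 * r by rewrite ler_norml; lra.
  by rewrite /r; lra.
have boxD x y : a1 - 2 * r <= x <= a1 + 2 * r -> a2 - 2 * r <= y <= a2 + 2 * r ->
    disk (x +i* y).
  by move=> hx hy; apply/diskE; have := box x y hx hy; lra.
have NK x y : a1 - 2 * r <= x <= a1 + 2 * r -> a2 - 2 * r <= y <= a2 + 2 * r ->
    ((r * normc (D (x +i* y)))%:E <= 1 + (r ^+ 2)%:E * K (x, y))%E.
  move=> hx hy; rewrite /K patchE mem_set; last exact: boxD.
  rewrite /comp /besov_weight DE -EFinM -EFinD lee_fin.
  have hW : r <= 1 - normc (x +i* y) ^+ 2.
    have := box x y hx hy; have := normc_ge0 (x +i* y).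
    move: (normc (x +i* y)) => n n0 n1.
    have : n ^+ 2 <= n by rewrite expr2 ler_piMr//; lra.
    by lra.
  exact: (le_one_add_weight p2 r0 (normc_ge0 (D (x +i* y))) hW).
have [x0 hx0 Kx0] := @good_vertical_line R K (a1 - 2 * r) r I r0 I0 mK K0 KI.
have [x1 hx1 Kx1] := @good_vertical_line R K (a1 + r) r I r0 I0 mK K0 KI.
have [y0 hy0 Ky0] := @good_horizontal_line R K (a2 - 2 * r) r I r0 I0 mK K0 KI.
have [y1 hy1 Ky1] := @good_horizontal_line R K (a2 + r) r I r0 I0 mK K0 KI.
have V x : a1 - 2 * r <= x <= a1 + 2 * r ->
    (\int[mu]_y K (x, y) <= ((I + 1) / r)%:E)%E ->
    seg_integral (fun y => normc (D (x +i* y))) y0 y1 <= I + 5.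
  move=> hx Kx; apply: (@seg_le_slice R _ (fun y => K (x, y)) y0 y1 r) => //;
    try by clear -r0 hy0 hy1; lra.
  - move=> y; rewrite in_itv/= => hy; apply: normc_continuous_vertical.
    by apply: cD; apply: boxD => //; clear -hy hy0 hy1; lra.
  - by move=> y; exact: normc_ge0.
  - exact: measurable_fun_pair2.
  - by move=> y; rewrite in_itv/= => hy; apply: NK => //; clear -hy hy0 hy1; lra.
have H y : a2 - 2 * r <= y <= a2 + 2 * r ->
    (\int[mu]_x K (x, y) <= ((I + 1) / r)%:E)%E ->
    seg_integral (fun x => normc (D (x +i* y))) x0 x1 <= I + 5.
  move=> hy Ky; apply: (@seg_le_slice R _ (fun x => K (x, y)) x0 x1 r) => //;
    try by clear -r0 hx0 hx1; lra.
  - move=> x; rewrite in_itv/= => hx; apply: normc_continuous_horizontal.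
    by apply: cD; apply: boxD => //; clear -hx hx0 hx1; lra.
  - by move=> x; exact: normc_ge0.
  - exact: measurable_fun_pair1.
  - by move=> x; rewrite in_itv/= => hx; apply: NK => //; clear -hx hx0 hx1; lra.
have S0 := V x0 ltac:(clear -hx0 r0; lra) Kx0.
have S1 := V x1 ltac:(clear -hx1 r0; lra) Kx1.
have S2 := H y0 ltac:(clear -hy0 r0; lra) Ky0.
have S3 := H y1 ltac:(clear -hy1 r0; lra) Ky1.
have rE : 1 - normc z = 8 * r by rewrite /r; field.
rewrite rE zE; clearbody r;
  clear V H Kx0 Kx1 Ky0 Ky1 NK mK K0 KI K box p2 I0 rE zE zD z1.
have dDc x y : x0 <= x <= x1 -> y0 <= y <= y1 ->
    cderivable g (x +i* y) /\ ccontinuous D (x +i* y).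
  by move=> hx hy; split; [apply: dg|apply: cD]; apply: boxD;
    clear -hx hy hx0 hx1 hy0 hy1; lra.
have := @derive1_side_integrals R g D a1 a2 r x0 x1 y0 y1 (I + 5) r0 DE
  ltac:(clear -hx0; lra) ltac:(clear -hx1; lra)
  ltac:(clear -hy0; lra) ltac:(clear -hy1; lra) dDc S0 S1 S2 S3.
by rewrite ler_pdivlMr//; lra.
Qed.

End bloch.

(** * A Schwarz-Pick inequality *)

Section schwarz_pick.
Context {R : realType}.
Local Notation cderive g := (derive1 (g : R[i]^o -> R[i]^o)).
Implicit Types (F G f g phi : R[i] -> R[i]) (z w a b B : R[i]).

Lemma has_cderiv_comp f g z (A B : R[i]) :
  has_cderiv f (g z) A -> has_cderiv g z B -> has_cderiv (f \o g) z (A * B).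
Proof.
move=> df dg e e0.
have nA := normc_ge0 A; have nB := normc_ge0 B.
have [d1 d10 H1] := df (e / (2 * (normc B + 1))) ltac:(rewrite divr_gt0//; lra).
pose e2 := Num.min 1 (e / (2 * (normc A + 1))).
have e20 : 0 < e2 by rewrite lt_min ltr01 divr_gt0//; lra.
have e21 : e2 <= 1 by rewrite ge_min lexx.
have e2A : normc A * e2 <= e / 2.
  apply: (@le_trans _ _ ((normc A + 1) * (e / (2 * (normc A + 1))))).
    by apply: ler_pM => //; [exact: ltW|lra|rewrite ge_min lexx orbT].
  by rewrite le_eqVlt; apply/orP; left; apply/eqP; field; lra.
have [d2 d20 H2] := dg e2 e20.
have [d3 d30 H3] := has_cderiv_ccontinuous dg d10.
exists (Num.min d2 d3) => [|w]; first by rewrite lt_min d20.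
rewrite lt_min => /andP[w2 w3] /=.
have h1 := H1 (g w) (H3 w w3); have h2 := H2 w w2.
have wz := normc_ge0 (w - z).
have h3 : normc (g w - g z) <= (normc B + 1) * normc (w - z).
  have -> : g w - g z = (g w - g z - B * (w - z)) + B * (w - z) by ring.
  apply: (le_trans (le_normcD _ _)); rewrite normcM.
  have : e2 * normc (w - z) <= 1 * normc (w - z) by rewrite ler_wpM2r.
  by lra.
have -> : f (g w) - f (g z) - A * B * (w - z) =
    (f (g w) - f (g z) - A * (g w - g z)) + A * (g w - g z - B * (w - z)) by ring.
apply: (le_trans (le_normcD _ _)); rewrite normcM.
have h4 : normc A * normc (g w - g z - B * (w - z)) <= e / 2 * normc (w - z).
  apply: (@le_trans _ _ (normc A * (e2 * normc (w - z)))); first by rewrite ler_wpM2l.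
  by rewrite mulrA ler_wpM2r.
have h5 : e / (2 * (normc B + 1)) * normc (g w - g z) <= e / 2 * normc (w - z).
  apply: (@le_trans _ _ (e / (2 * (normc B + 1)) * ((normc B + 1) * normc (w - z)))).
    by rewrite ler_wpM2l// divr_ge0//; lra.
  by rewrite le_eqVlt; apply/orP; left; apply/eqP; field; lra.
lra.
Qed.

Lemma cderivable_comp f g z : cderivable f (g z) -> cderivable g z -> cderivable (f \o g) z.
Proof. by move=> [A dA] [B dB]; exists (A * B); exact: has_cderiv_comp. Qed.

Lemma has_cderiv_mul_zero F G z A : F z = 0 -> has_cderiv F z A -> cderivable G z ->
  has_cderiv (fun w => F w * G w) z (A * G z).
Proof.
move=> F0 /has_cderivP dF /cderivable_has_cderiv/has_cderivP dG; apply/has_cderivP.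
have := is_deriveM dF dG; rewrite F0 scale0r add0r => H.
by apply: is_derive_eq H _; rewrite mulrC.
Qed.

Lemma normc_sqr (x y : R) : normc (x +i* y) ^+ 2 = x ^+ 2 + y ^+ 2.
Proof. by rewrite /= sqr_sqrtr// addr_ge0 ?sqr_ge0. Qed.

Lemma normc_conj z : normc z^*%C = normc z.
Proof. by case: z => x y /=; rewrite sqrrN. Qed.

(** The difference of the squares of the two sides is
    (1 - |w|^2) (1 - |b|^2). *)
Lemma moebius_le w b : normc w <= 1 -> normc b <= 1 ->
  normc (w - b) <= normc (1 - b^*%C * w).
Proof.
case: w b => [u v] [s t] wD bD.
rewrite -(@ler_pXn2r _ 2%N)// ?nnegrE ?normc_ge0//.
have -> : 1 - (s +i* t)^*%C * (u +i* v) =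
    (1 - (s * u + t * v)) +i* (- (s * v - t * u)) :> R[i].
  apply/eqP; rewrite eq_complex/=; apply/andP; split; apply/eqP; ring.
rewrite (_ : (u +i* v) - (s +i* t) = (u - s) +i* (v - t))// !normc_sqr.
have h1 : u ^+ 2 + v ^+ 2 <= 1.
  by rewrite -normc_sqr expr_le1// normc_ge0.
have h2 : s ^+ 2 + t ^+ 2 <= 1.
  by rewrite -normc_sqr expr_le1// normc_ge0.
have : 0 <= (1 - (u ^+ 2 + v ^+ 2)) * (1 - (s ^+ 2 + t ^+ 2)).
  by rewrite mulr_ge0// subr_ge0.
lra.
Qed.

Lemma cauchy_unit_disk g : (forall z, disk z -> cderivable g z) ->
  (forall z, disk z -> normc (g z) <= 1) ->
  normc (cderive g 0) <= 288.
Proof.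
move=> dg g1; pose k : R := 1 / 4.
have sq (x y : R) : - k <= x <= k -> - k <= y <= k -> disk (x +i* y).
  move=> hx hy; apply/diskE; apply: (le_lt_trans (normc_le_ReIm _)) => /=.
  have : `|x| <= k by rewrite ler_norml.
  by have : `|y| <= k by [rewrite ler_norml]; rewrite /k; lra.
have := @cauchy_estimate R g 0 0 0 k (- k) k (- k) k 1.
have -> : 72 * 1 / k = 288 by rewrite /k; field.
apply; rewrite /k; try lra.
- by move=> x y hx hy; apply: dg; exact: sq.
- by move=> x y hx hy _; rewrite subr0; apply: g1; exact: sq.
Qed.

(** Cauchy's estimate at 0 for psi = (phi - b) / (1 - conj(b) phi), b = phi(0), a
    self-map of the disc with psi'(0) = phi'(0) / (1 - |b|^2). *)
Lemma weak_schwarz_pick phi : (forall z, disk z -> cderivable phi z) ->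
  (forall z, disk z -> disk (phi z)) ->
  normc (cderive phi 0) <= 576 * (1 - normc (phi 0)).
Proof.
move=> dphi sphi; set b := phi 0.
have D0 : disk (0 : R[i]) by apply/diskE; rewrite normc0.
have bD : normc b < 1 by apply/diskE; exact: sphi.
pose den w := 1 - b^*%C * phi w.
pose psi w := (phi w - b) * (den w)^-1.
have den0 w : disk w -> den w != 0.
  move=> wD; apply/eqP => /(congr1 (@normc R)); rewrite normc0 => den0.
  have := le_normcD (den w) (b^*%C * phi w); rewrite /den subrK -/(den w) den0.
  rewrite normc1 normcM normc_conj add0r.
  have pw : normc (phi w) < 1 by apply/diskE; exact: sphi.
  have : normc b * normc (phi w) <= normc b * 1 by rewrite ler_wpM2l ?normc_ge0// ltW.
  by lra.
have dden w : disk w -> cderivable den w.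
  move=> wD; apply: cderivableB; first exact: cderivable_cst.
  by apply: cderivableM; [exact: cderivable_cst|exact: dphi].
have dpsi w : disk w -> cderivable psi w.
  move=> wD; apply: cderivableM.
    by apply: cderivableB; [exact: dphi|exact: cderivable_cst].
  by apply: cderivableV; [exact: den0|exact: dden].
have psi1 w : disk w -> normc (psi w) <= 1.
  move=> wD; rewrite normcM normcV ler_pdivrMr ?normc_gt0 ?den0// mul1r.
  by apply: moebius_le; [apply/ltW/diskE; exact: sphi|exact: ltW].
have := cauchy_unit_disk dpsi psi1.
move DE : (cderive phi 0) => P.
have dP : has_cderiv phi 0 P by rewrite -DE; apply: cderivable_has_cderiv; exact: dphi.
have dPb : has_cderiv (fun w => phi w - b) 0 P.
  move=> e /dP[d d0 Hd]; exists d => // w /Hd.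
  by rewrite opprB addrA subrK.
have dV := cderivableV (den0 _ D0) (dden _ D0).
rewrite (has_cderiv_derive1 (has_cderiv_mul_zero _ dPb dV)); last first.
  by rewrite /b subrr.
rewrite normcM normcV ler_pdivrMr ?normc_gt0 ?den0// => /le_trans; apply.
have -> : den 0 = (1 - normc b ^+ 2)%:C.
  rewrite /den -/b; case: (b) => s t; rewrite normc_sqr.
  by apply/eqP; rewrite eq_complex/=; apply/andP; split; apply/eqP; ring.
rewrite /= expr0n/= addr0 sqrtr_sqr ger0_norm; last first.
  by rewrite subr_ge0 expr_le1// ?normc_ge0// ltW.
have -> : 1 - normc b ^+ 2 = (1 - normc b) * (1 + normc b) by ring.
have : (1 - normc b) * (1 + normc b) <= (1 - normc b) * 2.
  by rewrite ler_wpM2l; lra.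
lra.
Qed.

End schwarz_pick.

(** * Orbits of weighted composition operators *)

Section orbits.
Context {R : realType}.
Local Notation cderive g := (derive1 (g : R[i]^o -> R[i]^o)).
Implicit Types (p : R) (phi : R[i] -> R[i]) (f g : R[i] -> R[i]^o).

Lemma holomorphic_diskP g : holomorphic_disk g <-> forall z, disk z -> cderivable g z.
Proof. by split=> H z /H; [move=> /cderivableP|move/cderivableP]. Qed.

Lemma iter_selfmap phi : holomorphic_selfmap phi ->
  forall n, (forall z, disk z -> cderivable (iter n phi) z) /\
            (forall z, disk z -> disk (iter n phi z)).
Proof.
move=> [/holomorphic_diskP dphi sphi]; elim=> [|n [IH1 IH2]].
  by split=> // z _; exact: cderivable_id.
split=> z zD /=; last exact: sphi (IH2 z zD).
by apply: (@cderivable_comp R phi (iter n phi) z); [exact: dphi (IH2 z zD)|exact: IH1].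
Qed.

Lemma iter_weighted_composition (lam : R[i]) phi f n z :
  iter n (fun g => lam *: comp_op phi g) f z = lam ^+ n * f (iter n phi z).
Proof.
elim: n z => [|n IH] z; first by rewrite expr0 mul1r.
by rewrite iterS exprS -mulrA iterSr -IH.
Qed.

Lemma area_disk_lty : (area_measure (@disk_xy R) < +oo)%E.
Proof.
pose Q : set (R * R) := `[-1, 1] `*` `[-1, 1].
have mQ : measurable Q by apply: measurableX; exact: measurable_itv.
apply: (@le_lt_trans _ _ (area_measure Q)).
  apply: le_measure; rewrite ?inE//; first exact: measurable_disk_xy.
  move=> [x y] /diskE xy1; split; rewrite /= in_itv/= -ler_norml; apply/ltW.
    exact: le_lt_trans (ler_abs_Re (x +i* y)) xy1.
  exact: le_lt_trans (ler_abs_Im (x +i* y)) xy1.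
rewrite /area_measure product_measure1E; try exact: measurable_itv.
by rewrite /= !lebesgue_measure_itv/= lte_fin; case: ifP => _; rewrite -?EFinB -?EFinM ltry.
Qed.

Lemma has_cderiv_linear (c : R[i]) z : has_cderiv (fun w => c * w) z c.
Proof.
by move=> e e0; exists 1 => // w _; rewrite -mulrBr subrr normc0 mulr_ge0// ?normc_ge0// ltW.
Qed.

Lemma has_cderivB (F G : R[i] -> R[i]) (z A B : R[i]) :
  has_cderiv F z A -> has_cderiv G z B -> has_cderiv (fun w => F w - G w) z (A - B).
Proof.
by move=> /has_cderivP dF /has_cderivP dG; apply/has_cderivP; exact: is_deriveB dF dG.
Qed.

Lemma has_cderiv_scale (c : R[i]) (F : R[i] -> R[i]) (z A : R[i]) :
  has_cderiv F z A -> has_cderiv (fun w => c * F w) z (c * A).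
Proof.
by move=> dF; exact: (has_cderiv_comp (f := fun w => c * w) (@has_cderiv_linear c (F z)) dF).
Qed.

(** For p >= 2 the weight is at most 1, and the disc has finite area. *)
Lemma linear_besov p (c : R[i]) : 2 <= p -> besov p (fun z => c * z : R[i]^o).
Proof.
move=> p2.
have dl z : cderivable (fun w => c * w) z by exists c; exact: has_cderiv_linear.
have D1 z : cderive (fun w => c * w) z = c.
  exact: has_cderiv_derive1 (@has_cderiv_linear c z).
split; first by apply/holomorphic_diskP => z _; exact: dl.
apply: (@le_lt_trans _ _ (\int[area_measure]_(w in @disk_xy R) cst (normc c `^ p)%:E w)%E).
  apply: ge0_le_integral => //.
  - exact: measurable_disk_xy.
  - by move=> w _; rewrite lee_fin mulr_ge0 ?powR_ge0.
  - by apply/measurable_EFinP; apply: measurable_besov_weight => z _; exact: dl.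
  - move=> w /diskE w1; rewrite lee_fin D1 -[leRHS]mulr1 ler_wpM2l ?powR_ge0//.
    have n0 := normc_ge0 (w.1 +i* w.2).
    have h : 0 <= 1 - normc (w.1 +i* w.2) ^+ 2 <= 1.
      by rewrite subr_ge0 expr_le1// ltW// gerBl sqr_ge0.
    apply: (@le_trans _ _ (1 `^ (p - 2))); last by rewrite powR1.
    by apply: ge0_ler_powR; rewrite ?nnegrE; lra.
rewrite integral_cst; last exact: measurable_disk_xy.
by rewrite lte_mul_pinfty ?lee_fin ?powR_ge0// area_disk_lty.
Qed.

Lemma besov_integral_ge0 p g : (0 <= besov_integral p g)%E.
Proof. by apply: integral_ge0 => w _; rewrite lee_fin mulr_ge0 ?powR_ge0. Qed.

Lemma besov_norm_lt1 p g : 0 < p -> (besov_norm p g < 1%:E)%E ->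
  (besov_integral p g <= 1%:E)%E.
Proof.
move=> p0; apply: contraTT; rewrite -ltNge -leNgt => I1.
have J1 : (1 <= (normc (g 0) `^ p)%:E + besov_integral p g)%E.
  by rewrite -[leLHS]add0e leeD// ?lee_fin ?powR_ge0// ltW.
rewrite /besov_norm -[leLHS](poweR1r p^-1).
apply: gt0_ler_poweR => //; rewrite ?invr_ge0 ?in_itv/= ?leey ?andbT ?(ltW p0)//.
exact: le_trans J1.
Qed.

Lemma cderivable_orbit (lam : R[i]) phi f n : holomorphic_selfmap phi ->
  (forall z, disk z -> cderivable f z) ->
  forall z, disk z -> cderivable (iter n (fun g => lam *: comp_op phi g) f) z.
Proof.
move=> hphi df; have [dn sn] := iter_selfmap hphi n.
have -> : iter n (fun g => lam *: comp_op phi g) f =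
    (fun z => lam ^+ n * (f \o iter n phi) z).
  by apply/funext => z; exact: iter_weighted_composition.
move=> z zD; apply: cderivableM; first exact: cderivable_cst.
by apply: cderivable_comp; [exact: df (sn z zD)|exact: dn].
Qed.

(** The loss 1 - |phi_n(0)| in the Bloch estimate at phi_n(0) is exactly the gain
    in the Schwarz-Pick inequality for phi_n. *)
Lemma orbit_derivative_bounded p (lam : R[i]) phi f : 2 <= p -> normc lam = 1 ->
  holomorphic_selfmap phi -> besov p f ->
  exists M : R, forall n, normc
    (cderive (iter n (fun g => lam *: comp_op phi g) f) 0) <= M.
Proof.
move=> p2 lam1 hphi [/holomorphic_diskP df fI].
have D0 : disk (0 : R[i]) by apply/diskE; rewrite normc0.
pose I := fine (besov_integral p f).
have If : (besov_integral p f <= I%:E)%E.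
  by rewrite /I fineK// ge0_fin_numE// besov_integral_ge0.
have I0 : 0 <= I by rewrite /I fine_ge0// besov_integral_ge0.
exists (576 * (2304 * (I + 5))) => n.
have [dn sn] := iter_selfmap hphi n.
pose P := cderive (iter n phi) 0.
pose Q := cderive f (iter n phi 0).
have -> : cderive (iter n (fun g => lam *: comp_op phi g) f) 0 = lam ^+ n * (Q * P).
  have -> : iter n (fun g => lam *: comp_op phi g) f =
      (fun z => lam ^+ n * (f \o iter n phi) z).
    by apply/funext => z; exact: iter_weighted_composition.
  apply: has_cderiv_derive1; apply: has_cderiv_scale.
  by apply: has_cderiv_comp; apply: cderivable_has_cderiv; [exact: df (sn 0 D0)|exact: dn].
have hP : normc P <= 576 * (1 - normc (iter n phi 0)) by exact: weak_schwarz_pick.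
have hQ : normc Q * (1 - normc (iter n phi 0)) <= 2304 * (I + 5).
  exact: (bloch_estimate p2 I0 df If (sn 0 D0)).
have lamn : normc (lam ^+ n) = 1.
  by elim: (n) => [|k IH]; rewrite ?expr0 ?normc1// exprS normcM IH lam1 mulr1.
rewrite normcM lamn mul1r normcM.
apply: (@le_trans _ _ (normc Q * (576 * (1 - normc (iter n phi 0))))).
  by rewrite ler_wpM2l// normc_ge0.
by rewrite mulrCA; exact: (ler_wpM2l (ler0n _ 576) hQ).
Qed.

Lemma besov_unit_ball_derivative p : 2 <= p -> exists C : R, forall g,
  (forall z, disk z -> cderivable g z) -> (besov_norm p g < 1%:E)%E ->
  normc (cderive g 0) <= C.
Proof.
move=> p2; exists (2304 * (1 + 5)) => g dg.
move=> /(besov_norm_lt1 (lt_le_trans (ltr0Sn _ 1) p2)) gI.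
have D0 : disk (0 : R[i]) by apply/diskE; rewrite normc0.
have := bloch_estimate p2 ler01 dg gI D0.
by rewrite normc0 subr0 mulr1.
Qed.

End orbits.

Unset Implicit Arguments.
Set Strict Implicit.
Set Printing Implicit Defensive.

Theorem corollary4p3 (R : realType) (p : R) (lam : R[i]) (phi : R[i] -> R[i])
    (hp : 2 <= p) (hlam : `|lam| = 1) (hphi : holomorphic_selfmap phi)
    (hC : bounded_linear_operator (besov p) (besov_norm p) (comp_op phi)) :
  ~ hypercyclic (besov p) (besov_norm p) (fun f => lam *: comp_op phi f).
Proof.
move=> [f fB dense].
have lam1 : normc lam = 1 by move: hlam; rewrite normr_normc => -[].
have [M orbM] := orbit_derivative_bounded hp lam1 hphi fB.
have [C unitC] := besov_unit_ball_derivative hp.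
(* Larger than the bound along the orbit by more than C. *)
pose c : R := `|M + C| + 1.
have c0 : 0 <= c by rewrite addr_ge0.
pose g : R[i] -> R[i]^o := fun z => c%:C * z.
have [_ [n _ <-]] := dense g (linear_besov c%:C hp) 1 ltr01.
have dh := cderivable_orbit lam n hphi (proj1 (holomorphic_diskP f) (proj1 fB)).
move: (iter n _ f) (orbM n) dh => h hM dh hg.
have dg z : has_cderiv g z c%:C by exact: has_cderiv_linear.
have dhg z : disk z -> cderivable (h - g : R[i] -> R[i]^o) z.
  by move=> zD; apply: cderivableB; [exact: dh|exists c%:C; exact: dg].
have D0 : disk (0 : R[i]) by apply/diskE; rewrite normc0.
have small := unitC _ dhg hg.
have dhg0 := has_cderivB (cderivable_has_cderiv (dh 0 D0)) (dg 0).
rewrite (has_cderiv_derive1 (G := h - g) dhg0) in small.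
have cMC : c <= M + C.
  rewrite -(normc_real c0) -[c%:C](subKr (derive1 h 0)).
  by rewrite (le_trans (le_normcD _ _))// normcN lerD.
have := le_trans cMC (ler_norm _).
by rewrite /c gerDl ler10.
Qed.
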